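(* 1. Let $\mathfrak g$ be a Lie algebra and let $\mu_{\mathcal D}$ be an orthogonal structure on $T^*\mathfrak g$, written as $$\mu_{\mathcal D}((x,f),(y,g))=\langle g,j_{11}(x)\rangle+\langle f,j_{11}(y)\rangle+\langle g,j_{21}(f)\rangle+\langle j_{12}(x),y\rangle\qquad(\ast)$$ with $j_{11},j_{12},j_{21}$ as described in the context. Any $\mu_{\mathcal D}$-skew-symmetric prederivation $\phi$ of $T^*\mathfrak g$ has the form $$\phi(x,f)=\big(\alpha(x)+\psi(f),\ \beta(x)+(j'^t-\alpha^t)(f)\big),$$ where $j'\in\mathcal J'$, $\alpha\in\mathrm{Pder}(\mathfrak g)$, and $\beta:\mathfrak g\to\mathfrak g^*$, $\psi:\mathfrak g^*\to\mathfrak g$ are linear maps with $$\beta([x,[y,z]])=-ad^*_{[y,z]}(\beta(x))+ad^*_x\big(ad^*_y(\beta(z))-ad^*_z(\beta(y))\big),$$ $$\psi\circ ad^*_x\circ ad^*_y=ad_x\circ ad_y\circ\psi,\qquad ad^*_x\big(ad^*_{\psi(f)}g-ad^*_{\psi(g)}f\big)=0,$$ and with the additional conditions $$\langle\beta(x),j_{11}(y)\rangle+\langle\beta(y),j_{11}(x)\rangle+\langle j_{12}\circ\alpha(x),y\rangle+\langle j_{12}\circ\alpha(y),x\rangle=0,$$ $$\langle f,j_{11}\circ\psi(g)\rangle+\langle g,j_{11}\circ\psi(f)\rangle+\langle f,j'\circ j_{21}(g)\rangle+\langle g,j'\circ j_{21}(f)\rangle-\langle f,\alpha\circ j_{21}(g)\rangle-\langle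 g,\alpha\circ j_{21}(f)\rangle=0,$$ $$[j_{11},\alpha]+j_{21}\circ\beta+j'\circ j_{11}+\psi^t\circ j_{12}=0,$$ for all $x,y,z\in\mathfrak g$ and $f,g\in\mathfrak g^*$. 2. Let $(\mathfrak g,\mu)$ be an orthogonal Lie algebra, $\theta:\mathfrak g\to\mathfrak g^*$ the isomorphism $\langle\theta(x),y\rangle=\mu(x,y)$, and let $\mu_{\mathcal D}$ be any orthogonal structure on $T^*\mathfrak g$, written as $$\mu_{\mathcal D}((x,f),(y,g))=\langle g,j_{11}(x)\rangle+\langle f,j_{11}(y)\rangle+\langle g,j_2\circ\theta^{-1}(f)\rangle+\langle\theta\circ j_1(x),y\rangle\qquad(\ast\ast)$$ with $j_{11},j_1,j_2$ as described in the context. Then any prederivation $\phi$ of $T^*\mathfrak g$ which is skew-symmetric with respect to $\mu_{\mathcal D}$ can be written $$\phi(x,f)=\big(\alpha_1(x)+j_1'\circ\theta^{-1}(f),\ \theta\circ\alpha_2(x)+({j_2'}^t-\alpha_1^t)(f)\big),$$ where $\alpha_1,\alpha_2\in\mathrm{Pder}(\mathfrak g)$ and $j_1',j_2'\in\mathcal J'$ satisfy $$\theta\circ j_1\circ\alpha_1+\alpha_1^t\circ\theta\circ j_1+\alpha_2^t\circ\theta\circ j_{11}=0,$$ $$(j_{11}\circ j_1'+j_2'\circ j_2-\alpha_1\circ j_2)\circ\theta^{-1}+j_2\circ\theta^{-1}\circ({j_2'}^t-\alpha_1^t)+\theta^{-t}\circ{j_1'}^t\circ j_{11}^t=0,$$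 $$[j_{11},\alpha_1]+j_2\circ\alpha_2+j_2'\circ j_{11}+\theta^{-t}\circ{j_1'}^t\circ\theta\circ j_1=0,$$ where $\theta^{-t}$ is the transpose of $\theta^{-1}$. 3. Let $\mathfrak g$ be a semi-simple Lie algebra. Then any prederivation of $T^*\mathfrak g$ which is skew-symmetric with respect to any orthogonal structure $\mu_{\mathcal D}$ on $T^*\mathfrak g$ is an inner derivation of $T^*\mathfrak g$.
   Context: Lie algebras are real and finite dimensional. An orthogonal structure on a Lie algebra is a non-degenerate symmetric bilinear form $B$ with $B([x,y],z)+B(y,[x,z])=0$; an orthogonal Lie algebra is one equipped with such a form. A prederivation of $\mathfrak h$ is a linear map $p$ with $p([x,[y,z]])=[p(x),[y,z]]+[x,[p(y),z]]+[x,[y,p(z)]]$; $\mathrm{Pder}(\mathfrak h)$ is the Lie algebra of these. A prederivation $\phi$ is $B$-skew-symmetric if $B(\phi(u),v)+B(u,\phi(v))=0$ for all $u,v$. $ad^*_xf=-f\circ ad_x$; $T^*\mathfrak g=\mathfrak g\ltimes\mathfrak g^*$ has bracket $[(x,f),(y,g)]=([x,y],ad^*_xg-ad^*_yf)$; $\langle x,f\rangle=\langle f,x\rangle=f(x)$; ${}^t$ denotes transpose, with $\mathfrak g^{**}=\mathfrak g$; $[A,B]=A\circ B-B\circ A$ for endomorphisms. $\mathcal J=\{j:\mathfrak g\to\mathfrak g\text{ linear}: j([x,y])=[j(x),y]\ \forall x,y\}$ and $\mathcal J'=\{j:\mathfrak g\to\mathfrak g\text{ linear}: [j,ad_x\circ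 ad_y]=0\ \forall x,y\}$. In $(\ast)$ (the paper's general form of an orthogonal structure on $T^*\mathfrak g$): $j_{11}:\mathfrak g\to\mathfrak g$, $j_{12}:\mathfrak g\to\mathfrak g^*$, $j_{21}:\mathfrak g^*\to\mathfrak g$ are linear with $j_{11}\circ ad_x=ad_x\circ j_{11}$, $j_{12}\circ ad_x=ad^*_x\circ j_{12}$, $j_{21}\circ ad^*_x=ad_x\circ j_{21}=0$, $\langle j_{12}(x),y\rangle=\langle x,j_{12}(y)\rangle$, $\langle j_{21}(f),g\rangle=\langle f,j_{21}(g)\rangle$. In $(\ast\ast)$ (the paper's general form when $\mathfrak g$ is orthogonal): $j_{11},j_1,j_2\in\mathcal J$, $j_{11}$ is invertible, $\mu(j_1(x),y)=\mu(x,j_1(y))$, $j_2\circ ad_x=0$ and $\langle j_2\circ\theta^{-1}(f),g\rangle=\langle f,j_2\circ\theta^{-1}(g)\rangle$ for all $x,y\in\mathfrak g$, $f,g\in\mathfrak g^*$.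
   Formalization: In part 2 the first displayed condition is corrected by adding the missing summand $j_{11}^t\circ\theta\circ\alpha_2$; as printed it fails for abelian $\mathbb R^2$ with $j_{11}=\mathrm{id}$, $j_1=j_2=0$, $\phi(x,f)=(0,\theta(Ax))$, $A$ a rotation by $\pi/2$. *)

(* Defs.v *)
From HB Require Import structures.
From mathcomp Require Import all_boot all_order all_algebra.
From mathcomp Require Import reals ring.

Set Implicit Arguments.
Unset Strict Implicit.
Unset Printing Implicit Defensive.

Import GRing.Theory.
Local Open Scope ring_scope.

HB.mixin Record Vector_isLieAlgebra (R : fieldType) L of Vector R L := {
  lie : L -> L -> L;
  lie_linearl : forall y, linear (lie^~ y);
  lie_linearr : forall x, linear (lie x);
  lie_alt : forall x, lie x x = 0;
  lie_jacobi : forall x y z,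
    lie x (lie y z) + lie y (lie z x) + lie z (lie x y) = 0
}.

#[short(type="lieAlgType")]
HB.structure Definition LieAlgebra (R : fieldType) :=
  { L of Vector R L & Vector_isLieAlgebra R L }.

Notation "[ 'lie' x , y ]" := (lie x y)
  (at level 0, x, y at level 99, format "[ 'lie'  x ,  y ]") : ring_scope.

HB.instance Definition _ (R : fieldType) (L : lieAlgType R) (x : L) :=
  GRing.isLinear.Build R L L *:%R (lie x) (lie_linearr x).

(* The pairing <x, f> = <f, x> is application, [f x].                          *)
Notation dual V := 'Hom(V, _^o).

Section LinearAlgebra.
Variables (R : fieldType).

Definition lfun_comm (V : vectType R) (A B : 'End(V)) : 'End(V) :=
  (A \o B)%VF - (B \o A)%VF.

Definition tr (U V : vectType R) (u : 'Hom(U, V)) : 'Hom(dual V, dual U) :=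
  linfun (fun f : dual V => (f \o u)%VF).

(* The canonical isomorphism V = V^**, <bidual x, f> = <f, x>.                 *)
Definition bidual (V : vectType R) : 'Hom(V, dual (dual V)) :=
  linfun (fun x => linfun (fun f : dual V => f x)).

(* The transpose of u : U^* -> V, with U^** identified with U; [tr_dualE]      *)
(* characterizes it.                                                           *)
Definition tr_dual (U V : vectType R) (u : 'Hom(dual U, V)) : 'Hom(dual V, U) :=
  ((bidual U)^-1 \o tr u)%VF.

Fact tr_linear (U V : vectType R) (u : 'Hom(U, V)) :
  linear (fun f : dual V => (f \o u)%VF : dual U).
Proof. by move=> a f g; apply/lfunP=> x; rewrite !lfun_simp. Qed.

Lemma trE (U V : vectType R) (u : 'Hom(U, V)) (f : dual V) :
  tr u f = (f \o u)%VF.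
Proof.
pose t : {linear dual V -> dual U} := HB.pack (fun f : dual V => (f \o u)%VF)
  (GRing.isLinear.Build R (dual V) (dual U) _ _ (tr_linear u)).
exact: (lfunE t).
Qed.

Lemma bidualE (V : vectType R) (x : V) (f : dual V) : bidual V x f = f x.
Proof.
have evl y : linear (fun f : dual V => f y).
  by move=> a g h; rewrite add_lfunE scale_lfunE.
pose ev y : {linear dual V -> R^o} := HB.pack (fun f : dual V => f y)
  (GRing.isLinear.Build R (dual V) R^o _ _ (evl y)).
have bl : linear (fun y => linfun (ev y)).
  by move=> a y z; apply/lfunP=> g; rewrite !lfun_simp /= linearP.
pose b : {linear V -> dual (dual V)} := HB.pack (fun y => linfun (ev y))
  (GRing.isLinear.Build R V (dual (dual V)) _ _ bl).
have -> : bidual V x = linfun (ev x) by exact: (lfunE b).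
exact: (lfunE (ev x)).
Qed.

Lemma tr_dualE (U V : vectType R) (u : 'Hom(dual U, V)) (h : dual V) (f : dual U) :
  f (tr_dual u h) = h (u f).
Proof.
have inj : lker (bidual U) == 0%VS.
  apply/lker0P => x y exy; rewrite [LHS](coord_vbasis (memvf x)).
  rewrite [RHS](coord_vbasis (memvf y)); apply: eq_bigr => i _; congr (_ *: _).
  pose c : {linear U -> R^o} := HB.pack (fun z => coord (vbasis {:U}) i z)
    (GRing.isLinear.Build R U R^o _ (fun z => coord (vbasis {:U}) i z)
      (linearP (coord (vbasis {:U}) i))).
  by have := congr1 (fun t : dual (dual U) => t (linfun c)) exy;
     rewrite !bidualE !lfunE.
have surj : limg (bidual U) = fullv.
  apply/eqP; rewrite eqEdim subvf /= limg_dim_eq ?(eqP inj) ?capv0 //.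
  by rewrite !dimvf -[X in (X <= _)%N]/(dim U * 1 * 1)%N !muln1.
rewrite -bidualE /tr_dual comp_lfunE limg_lfunVK ?surj ?memvf //.
by rewrite trE comp_lfunE.
Qed.

End LinearAlgebra.

Section LieTheory.
Variables (R : fieldType) (L : lieAlgType R).

Definition ad (x : L) : 'End(L) := linfun (lie x).

Definition coad (x : L) : 'End(dual L) := - tr (ad x).

Definition inner_derivation (phi : 'End(L)) := exists x : L, phi = ad x.

Definition prederivation (p : 'End(L)) := forall x y z : L,
  p [lie x, [lie y, z]] =
    [lie p x, [lie y, z]] + [lie x, [lie p y, z]] + [lie x, [lie y, p z]].

Definition orthogonal_structure (B : {symmetric L}) :=
  nondegenerate B /\ forall x y z : L, B [lie x, y] z + B y [lie x, z] = 0.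

Definition skew_for (B : {symmetric L}) (phi : 'End(L)) :=
  forall u v : L, B (phi u) v + B u (phi v) = 0.

Definition centroid (j : 'End(L)) :=
  forall x y : L, j [lie x, y] = [lie j x, y].

(* The analogue of [centroid] for prederivations: j commutes with all products *)
(* ad_x ad_y.                                                                  *)
Definition precentroid (j : 'End(L)) :=
  forall x y : L, lfun_comm j (ad x \o ad y)%VF = 0.

Definition lie_ideal (I : {vspace L}) :=
  forall x y : L, y \in I -> [lie x, y] \in I.

Definition lie_prodv (U V : {vspace L}) : {vspace L} :=
  <<[seq [lie u, v] | u <- vbasis U, v <- vbasis V]>>%VS.

Definition derived_series (U : {vspace L}) (n : nat) : {vspace L} :=
  iter n (fun V => lie_prodv V V) U.

Definition lie_solvable (U : {vspace L}) :=
  exists n : nat, derived_series U n = 0%VS.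

Lemma adE (x y : L) : ad x y = [lie x, y].
Proof. exact: lfunE. Qed.

Lemma coadE (x : L) (f : dual L) : coad x f = - (f \o ad x)%VF.
Proof. by rewrite /coad opp_lfunE trE. Qed.

Lemma coad_apply (x : L) (f : dual L) (y : L) : coad x f y = - f [lie x, y].
Proof. by rewrite coadE opp_lfunE comp_lfunE adE. Qed.

Lemma lie_anti (x y : L) : [lie x, y] = - [lie y, x].
Proof.
have Dl z u v : [lie u + v, z] = [lie u, z] + [lie v, z].
  by have := lie_linearl z 1 u v; rewrite !scale1r.
have := lie_alt (x + y); rewrite Dl !linearD /= !lie_alt add0r addr0.
by move/eqP; rewrite addr_eq0 => /eqP.
Qed.

Lemma lie_prodvP (U V W : {vspace L}) :
  reflect (forall u v, u \in U -> v \in V -> [lie u, v] \in W)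
          (lie_prodv U V <= W)%VS.
Proof.
apply: (iffP idP) => [sUVW u v Uu Vv | sUVW]; last first.
  by apply/span_subvP => _ /allpairsP[[u v] /= [Uu Vv ->]];
     apply: sUVW; apply: vbasis_mem.
apply: (subvP sUVW).
rewrite (coord_vbasis Vv) linear_sum /=; apply: rpred_sum => i _.
rewrite linearZ /= memvZ // lie_anti memvN (coord_vbasis Uu) linear_sum /=.
apply: rpred_sum => j _; rewrite linearZ /= memvZ // lie_anti memvN.
by apply: memv_span; apply: allpairs_f; rewrite mem_nth ?size_tuple.
Qed.

End LieTheory.

Definition semisimple (R : fieldType) (L : lieAlgType R) :=
  forall I : {vspace L}, lie_ideal I -> lie_solvable I -> I = 0%VS.

(* T^*g, as an alias of the product so that it carries the semidirect bracket  *)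
(* rather than a componentwise one.                                            *)
Definition cotangent (R : fieldType) (g : lieAlgType R) := (g * dual g)%type.

HB.instance Definition _ (R : fieldType) (g : lieAlgType R) :=
  Vector.copy (cotangent g) (g * dual g)%type.

Section Cotangent.
Variables (R : fieldType) (g : lieAlgType R).
Implicit Types u v w : cotangent g.

Definition cotangent_lie u v : cotangent g :=
  ([lie u.1, v.1], coad u.1 v.2 - coad v.1 u.2).

Fact cotangent_lie_alt u : cotangent_lie u u = 0.
Proof. by rewrite /cotangent_lie lie_alt subrr. Qed.

Fact cotangent_lie_linearr u : linear (cotangent_lie u).
Proof.
move=> a v w; rewrite /cotangent_lie; congr (_, _) => /=; first by rewrite linearP.
apply/lfunP=> x; rewrite !(add_lfunE, opp_lfunE, scale_lfunE, coad_apply) /=.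
rewrite !opprK lie_linearl opprD -scalerN.
by rewrite [X in _ + X = _]linearP scalerDr addrACA.
Qed.

Fact cotangent_lie_linearl v : linear (cotangent_lie^~ v).
Proof.
have anti u w : cotangent_lie u w = - cotangent_lie w u.
  by rewrite /cotangent_lie lie_anti; congr (_, _); rewrite /= opprB.
by move=> a u w; rewrite !(anti _ v) cotangent_lie_linearr scalerN opprD.
Qed.

Fact cotangent_lie_jacobi u v w :
  cotangent_lie u (cotangent_lie v w) + cotangent_lie v (cotangent_lie w u)
    + cotangent_lie w (cotangent_lie u v) = 0.
Proof.
rewrite /cotangent_lie; congr (_, _) => /=; first exact: lie_jacobi.
apply/lfunP=> x; rewrite !(add_lfunE, opp_lfunE, zero_lfunE, coad_apply) /=.
have jac (a b c : g) : [lie [lie a, b], c] = [lie a, [lie b, c]] - [lie b, [lie a, c]].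
  have := lie_jacobi a b c; rewrite (lie_anti c [lie a, b]) (lie_anti c a).
  by rewrite linearN /= => /eqP; rewrite subr_eq0 => /eqP <-.
rewrite !jac (raddfB u.2) (raddfB v.2) (raddfB w.2).
have cancel (a b c d e f : R) : - (- a - - b) - - (c - d)
    + (- (- d - - e) - - (b - f)) + (- (- f - - c) - - (e - a)) = 0 by ring.
exact: cancel.
Qed.


HB.instance Definition _ := Vector_isLieAlgebra.Build R (cotangent g)
  cotangent_lie_linearl cotangent_lie_linearr cotangent_lie_alt
  cotangent_lie_jacobi.

End Cotangent.

(* Main.v *)
Require Import Defs.
From HB Require Import structures.
From mathcomp Require Import all_boot all_order all_algebra.
From mathcomp Require Import reals complex ring.

Set Implicit Arguments.
Unset Strict Implicit.
Unset Printing Implicit Defensive.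

Import Order.TTheory GRing.Theory Num.Theory.
Import VectorInternalTheory.
Local Open Scope ring_scope.

(** Write an endomorphism [phi] of T^*g as a 2 x 2 block of linear maps
[alpha], [beta], [psi], [xi] between g and g^*.  The first two parts are the
prederivation identity and the skew-symmetry read block by block: evaluating
them on vectors of g and of g^* gives every stated equation, once [xi] is
written as the transpose of [j'] minus the transpose of [alpha]. The identity
for [xi] on ad^*_x ad^*_y f is the transpose of the prederivation identity of
[alpha], up to a defect which says that [j'] commutes with all ad_y ad_x
([precentroid_shifted_transpose]). For g orthogonal, the isomorphism [theta]
intertwines ad and ad^*, so [beta] and [psi] turn into the endomorphisms
theta^-1 beta and psi theta of g ([skew_prederivation_form_orthogonal]).

For semisimple g, meaning that the only solvable ideal is 0, the proof has three
steps.

- The Killing form is nondegenerate ([semisimple_killing]). Let I be its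
  radical. For a in I, any b and any derivation D, invariance of the trace gives
  tr (ad [a, b] D) = - tr (ad a ad (D b)) = 0. A derivation A that is
  trace-orthogonal to all derivations is nilpotent ([derivation_nilpotent]):
  over the complex numbers, the operator D acting on each generalized eigenspace
  of A as the conjugate of the eigenvalue is a derivation, because brackets add
  eigenvalues and conjugation is additive, and tr (A D) is the sum of the
  squared moduli of the eigenvalues. So all elements of the ideal J = [I, I]
  are ad-nilpotent; by Engel's argument a nonzero J would have a nonzero centre,
  which is an abelian ideal of g. Hence J = 0, so I is an abelian ideal, so
  I = 0.

- T^*g is then perfect with trivial centre, and on such a Lie algebra every
  prederivation phi is a derivation ([prederivation_derivation]). Indeed
  [phi, ad w] is inner for w a bracket, hence for all w; write it ad (delta w).
  Then delta is a derivation with delta [x, y] = [phi x, y] + [x, phi y], and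
  comparing the available formulas shows that phi - delta takes central values.

- Subtracting an inner derivation from a derivation of T^*g leaves one that
  vanishes on g and maps g^* to itself ([derivation_inner_on_base],
  [derivation_fibre]): derivations of g are inner since the Killing form
  represents the linear forms x |-> tr (D ad x), cocycles g -> g^* become
  derivations of g through the Killing form, and the block psi : g^* -> g
  vanishes because it is compatible both with ad^* and with g^* being abelian.
  For what is left, skew-symmetry makes the values on g^* orthogonal to g; they
  are orthogonal to g^* because g^* = [g, g^*] is totally isotropic. So they
  vanish. *)

(** * Polynomial interpolation and generalized eigenvectors *)

Section Interpolation.
Variable K : fieldType.

Lemma coprimep_Xsub_prod (a : K) (s : seq K) (e : K -> nat) : a \notin s ->
  coprimep (('X - a%:P) ^+ e a) (\prod_(b <- s) ('X - b%:P) ^+ e b).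
Proof.
move=> as_; rewrite coprimep_sym; apply: coprimep_expr.
rewrite coprimep_XsubC rootE horner_prod big_seq prodf_seq_neq0.
apply/allP=> b bs; apply/implyP=> _.
rewrite horner_exp hornerXsubC expf_neq0 // subr_eq0.
by apply: contraNneq as_ => ->.
Qed.

(** The Chinese remainder theorem for powers of distinct linear factors. *)
Lemma interpolation (f : K -> K) (N : nat) (s : seq K) : uniq s ->
  exists q : {poly K}, forall a, a \in s -> ('X - a%:P) ^+ N %| q - (f a)%:P.
Proof.
elim: s => [|a s IHs] /=; first by exists 0.
move=> /andP[as_ us]; have [q qP] := IHs us.
have /Bezout_eq1_coprimepP[[u v] /= uv1] :=
  coprimep_Xsub_prod (fun=> N) as_.
set p := ('X - a%:P) ^+ N in uv1; set m := \prod_(b <- s) _ in uv1.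
exists ((f a)%:P * (v * m) + q * (u * p)) => b; rewrite inE => /orP[/eqP->|bs].
  have -> : (f a)%:P * (v * m) + q * (u * p) - (f a)%:P
          = (q - (f a)%:P) * u * p.
    by rewrite -[in X in _ - X = _](mulr1 (f a)%:P) -uv1; ring.
  exact: dvdp_mull.
have -> : (f a)%:P * (v * m) + q * (u * p) - (f b)%:P
        = ((f a)%:P - q) * v * m + (q - (f b)%:P).
  by rewrite -[in X in _ = _ + (X - _)](mulr1 q) -uv1; ring.
apply: dvdp_add; last exact: qP.
by apply: dvdp_mull; rewrite /m (big_rem b) //= dvdp_mulIl.
Qed.

(** The primary decomposition in the form of an induction principle: a vector
killed by a product of coprime factors is a sum of vectors killed by one of
them, so an additive property need only be checked on the latter. *)
Lemma generalized_eigenvector_ind n (A : 'M[K]_n.+1) (e : K -> nat)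
    (P : 'rV[K]_n.+1 -> Prop) (s : seq K) :
  uniq s -> P 0 -> (forall v w, P v -> P w -> P (v + w)) ->
  (forall a w, a \in s -> w *m horner_mx A (('X - a%:P) ^+ e a) = 0 -> P w) ->
  forall w, w *m horner_mx A (\prod_(a <- s) ('X - a%:P) ^+ e a) = 0 -> P w.
Proof.
move=> + P0 PD; elim: s => [|a s IHs] /=.
  by move=> _ _ w; rewrite big_nil rmorph1 mulmx1 => ->.
move=> /andP[as_ us] Ps w; rewrite big_cons.
have /Bezout_eq1_coprimepP[[u v] /= uv1] := coprimep_Xsub_prod e as_.
set p := ('X - a%:P) ^+ e a in uv1 *; set m := \prod_(b <- s) _ in uv1 *.
move=> wpm; have -> : w = w *m horner_mx A (u * p + v * m).
  by rewrite uv1 rmorph1 mulmx1.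
rewrite rmorphD mulmxDr.
apply: PD.
  apply: (IHs us) => [b x bs|]; first by apply: Ps; rewrite inE bs orbT.
  rewrite -mulmxA mulmxE -rmorphM -mulrA mulrC rmorphM -mulmxE mulmxA.
  by rewrite wpm mul0mx.
apply: (Ps a); first by rewrite inE eqxx.
rewrite -mulmxA mulmxE -rmorphM.
have -> : v * m * p = p * m * v by ring.
by rewrite rmorphM -mulmxE mulmxA wpm mul0mx.
Qed.

End Interpolation.

(** * Derivations of an algebra given by structure constants *)

Section MatrixDerivations.
Variables (K : fieldType) (n : nat) (E : 'I_n -> 'M[K]_n).
Implicit Types (u v : 'rV[K]_n) (D : 'M[K]_n).

(** The bilinear product on row vectors for which [E i] is the left
multiplication by the i-th basis vector, acting on rows from the right. *)
Definition mxprod u v := \sum_i u 0 i *: (v *m E i).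

Definition derivation_mx D :=
  forall i, E i *m D = D *m E i + \sum_j D i j *: E j.

Lemma mxprodDl u1 u2 v : mxprod (u1 + u2) v = mxprod u1 v + mxprod u2 v.
Proof. by rewrite -big_split; apply: eq_bigr => i _; rewrite mxE scalerDl. Qed.

Lemma mxprodDr u v1 v2 : mxprod u (v1 + v2) = mxprod u v1 + mxprod u v2.
Proof.
by rewrite -big_split; apply: eq_bigr => i _; rewrite mulmxDl scalerDr.
Qed.

Lemma mxprodZl a u v : mxprod (a *: u) v = a *: mxprod u v.
Proof. by rewrite scaler_sumr; apply: eq_bigr => i _; rewrite mxE scalerA. Qed.

Lemma mxprodZr a u v : mxprod u (a *: v) = a *: mxprod u v.
Proof.
rewrite scaler_sumr; apply: eq_bigr => i _.
by rewrite -scalemxAl !scalerA mulrC.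
Qed.

Lemma mxprod0l v : mxprod 0 v = 0.
Proof. by rewrite -[X in mxprod X _](scale0r 0) mxprodZl scale0r. Qed.

Lemma mxprod0r u : mxprod u 0 = 0.
Proof. by rewrite -[X in mxprod _ X](scale0r 0) mxprodZr scale0r. Qed.

Lemma mxprod_delta i v : mxprod (delta_mx 0 i) v = v *m E i.
Proof.
rewrite /mxprod (bigD1 i) //= mxE !eqxx scale1r big1 ?addr0 // => j ji.
by rewrite mxE (negPf ji) andbF scale0r.
Qed.

Lemma derivation_mxP D :
  derivation_mx D <->
  forall u v, mxprod u v *m D = mxprod (u *m D) v + mxprod u (v *m D).
Proof.
have mulD u v : mxprod (u *m D) v = \sum_i u 0 i *: (v *m \sum_j D i j *: E j).
  rewrite /mxprod; under eq_bigr => j _ do rewrite mxE scaler_suml.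
  rewrite exchange_big; apply: eq_bigr => i _ /=.
  rewrite mulmx_sumr scaler_sumr; apply: eq_bigr => j _ /=.
  by rewrite -scalemxAr scalerA.
split=> [DD u v|DD i].
  rewrite mulD /mxprod mulmx_suml -big_split; apply: eq_bigr => i _ /=.
  rewrite -scalemxAl -mulmxA DD mulmxDr mulmxA scalerDr; exact: addrC.
apply/row_matrixP=> k; rewrite !rowE mulmxDr mulmxA.
rewrite -mxprod_delta DD addrC mulD !mxprod_delta -mulmxA; congr (_ + _).
rewrite [LHS](bigD1 i) //= mxE !eqxx scale1r [X in _ + X]big1 ?addr0 // => j ji.
by rewrite mxE (negPf ji) andbF scale0r.
Qed.

End MatrixDerivations.

Section GeneralizedEigenvectors.
Variables (K : fieldType) (n : nat) (E : 'I_n.+1 -> 'M[K]_n.+1).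

Lemma horner_mx_Xsub_exp (A : 'M[K]_n.+1) a k :
  horner_mx A (('X - a%:P) ^+ k) = (A - a%:M) ^+ k.
Proof. by rewrite rmorphXn rmorphB /= horner_mx_X horner_mx_C. Qed.

(** Since A - (a + b) acts on a product through (A - a) on the left factor plus
(A - b) on the right factor, each application lowers one of the two nilpotency
orders. *)
Lemma mxprod_generalized_eigenvector (A : 'M[K]_n.+1) a b k l
    (u v : 'rV[K]_n.+1) :
  derivation_mx E A ->
  u *m (A - a%:M) ^+ k = 0 -> v *m (A - b%:M) ^+ l = 0 ->
  mxprod E u v *m (A - (a + b)%:M) ^+ (k + l) = 0.
Proof.
move=> /derivation_mxP DA; elim: k l u v => [|k IHk] l u v.
  by rewrite expr0 mulmx1 => ->; rewrite mxprod0l mul0mx.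
elim: l v => [|l IHl] v uk vl.
  by rewrite expr0 mulmx1 in vl; rewrite vl mxprod0r mul0mx.
have -> : mxprod E u v *m (A - (a + b)%:M) ^+ (k.+1 + l.+1)
  = (mxprod E (u *m (A - a%:M)) v + mxprod E u (v *m (A - b%:M)))
     *m (A - (a + b)%:M) ^+ (k + l.+1).
  rewrite addSn exprS -mulmxE mulmxA; congr (_ *m _).
  rewrite !mulmxBr !mul_mx_scalar DA mxprodDl mxprodDr.
  rewrite -!scaleN1r !mxprodZr !mxprodZl scalerDl scalerDr.
  by rewrite addrACA.
rewrite mulmxDl IHk ?add0r //; last by rewrite -mulmxA mulmxE -exprS.
rewrite addnS -addSn IHl //.
by rewrite -mulmxA mulmxE -exprS.
Qed.

End GeneralizedEigenvectors.

(** * A derivation orthogonal to all derivations is nilpotent *)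

Lemma trig_mul_diag (K : fieldType) n (A B : 'M[K]_n) :
  is_trig_mx A -> is_trig_mx B ->
  is_trig_mx (A *m B) /\ forall i, (A *m B) i i = A i i * B i i.
Proof.
move=> /is_trig_mxP tA /is_trig_mxP tB; split.
  apply/is_trig_mxP => i j ij; rewrite mxE big1 // => k _.
  have [ik|ki] := ltnP i k; first by rewrite tA ?mul0r.
  by rewrite tB ?mulr0 // (leq_ltn_trans ki).
move=> i; rewrite mxE (bigD1 i) //= big1 ?addr0 // => k ki.
have [ik|ik] := ltnP i k; first by rewrite tA ?mul0r.
by rewrite tB ?mulr0 // ltn_neqAle ik andbT.
Qed.

Lemma trig_horner_diag (K : fieldType) n (A : 'M[K]_n.+1) (p : {poly K}) :
  is_trig_mx A ->
  is_trig_mx (horner_mx A p) /\ forall i, horner_mx A p i i = p.[A i i].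
Proof.
move=> tA; elim/poly_ind: p => [|p c [tp dp]].
  by rewrite rmorph0; split=> [|i]; rewrite ?mx0_is_trig // mxE horner0.
have [tpA dpA] := trig_mul_diag tp tA.
rewrite rmorphD rmorphM /= horner_mx_X horner_mx_C -mulmxE; split.
  apply/is_trig_mxP => i j ij; rewrite mxE (is_trig_mxP tpA) // add0r.
  by rewrite mxE -val_eqE ltn_eqF.
by move=> i; rewrite mxE dpA dp mxE eqxx mulr1n hornerMXaddC.
Qed.

(** The test derivation is the conjugate of the semisimple part of A: a
polynomial q in A with q = conj a modulo a high power of X - a, for every
eigenvalue a. Then tr (A q(A)) is the sum of the squared moduli of the
eigenvalues. *)
Lemma derivation_mx_nilpotent (C : numClosedFieldType) n
    (E : 'I_n.+1 -> 'M[C]_n.+1) (A : 'M[C]_n.+1) :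
  derivation_mx E A ->
  (forall D, derivation_mx E D -> \tr (A *m D) = 0) -> A ^+ n.+1 = 0.
Proof.
move=> DA trA.
have [P /unitarymx_unit uP] := Schur A (ltn0Sn n).
rewrite /similar_to; set T := conjmx P A => tT.
have TE : T = P *m A *m invmx P by rewrite /T conjumx.
pose r := [seq T i i | i <- enum 'I_n.+1].
have chiA : horner_mx A (\prod_(a <- r) ('X - a%:P)) = 0.
  rewrite /r big_map big_enum /= -char_poly_trig //.
  apply/mxminpoly_minP; apply: dvdp_trans (mxminpoly_dvd_char T).
  by rewrite /T mxminpoly_uconj.
(* The sums of two eigenvalues are interpolation nodes too, because products of
   generalized eigenvectors have such sums as eigenvalues; the exponent doubles
   for the same reason. *)
pose s := undup (r ++ [seq a + b | a <- r, b <- r]).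
have [q qP] :=
  interpolation (fun a => a^*) (n.+1 + n.+1) (undup_uniq _ : uniq s).
have rs a : a \in r -> a \in s by move=> ra; rewrite mem_undup mem_cat ra.
have rrs a b : a \in r -> b \in r -> a + b \in s.
  by move=> ra rb; rewrite mem_undup mem_cat orbC allpairs_f.
have le_count a : (count_mem a r <= n.+1)%N.
  by rewrite (leq_trans (count_size _ _)) // size_map size_enum_ord.
(* On a generalized eigenvector q(A) acts as the conjugate of the eigenvalue. *)
have qE a k (w : 'rV_n.+1) : a \in s -> (k <= n.+1 + n.+1)%N ->
    w *m (A - a%:M) ^+ k = 0 -> w *m horner_mx A q = a^* *: w.
  move=> /qP/dvdpP[c qa] le_k wk; apply/eqP; rewrite -subr_eq0 -mul_mx_scalar.
  rewrite -mulmxBr -(horner_mx_C A) -rmorphB qa mulrC rmorphM -mulmxE mulmxA.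
  rewrite -(subnKC le_k) exprD rmorphM /= !horner_mx_Xsub_exp -mulmxE mulmxA wk.
  by rewrite !mul0mx.
have eigen_ind (P' : 'rV_n.+1 -> Prop) : P' 0 ->
    (forall v w, P' v -> P' w -> P' (v + w)) ->
    (forall a w, a \in r -> w *m (A - a%:M) ^+ n.+1 = 0 -> P' w) ->
    forall w, P' w.
  move=> P0 PD Pr w.
  apply: (@generalized_eigenvector_ind _ _ A
            (fun a => count_mem a r) _ (undup r)).
  - exact: undup_uniq.
  - exact: P0.
  - exact: PD.
  - move=> a v; rewrite mem_undup => ra; rewrite horner_mx_Xsub_exp => va.
    apply: (Pr a) => //; rewrite -[X in _ ^+ X](subnKC (le_count a)) exprD.
    by rewrite -mulmxE mulmxA va mul0mx.
  - by rewrite (prodr_undup_exp_count r xpredT) chiA mulmx0.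
have DD : derivation_mx E (horner_mx A q).
  apply/derivation_mxP => u v; move: u.
  apply: (eigen_ind _) => [|u1 u2|a u ra ua].
  - by rewrite !mul0mx !mxprod0l mul0mx addr0.
  - by move=> e1 e2; rewrite mulmxDl !mxprodDl mulmxDl e1 e2 addrACA.
  move: v; apply: (eigen_ind _) => [|v1 v2|b v rb vb].
  - by rewrite !mul0mx !mxprod0r mul0mx addr0.
  - by move=> e1 e2; rewrite mulmxDl !mxprodDr mulmxDl e1 e2 addrACA.
  have uv := mxprod_generalized_eigenvector DA ua vb.
  rewrite (qE _ _ _ (rrs _ _ ra rb) (leqnn _) uv).
  rewrite (qE _ _ _ (rs _ ra) _ ua) ?leq_addr //.
  rewrite (qE _ _ _ (rs _ rb) _ vb) ?leq_addr //.
  by rewrite mxprodZl mxprodZr rmorphD scalerDl.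
have q_diag i : q.[T i i] = (T i i)^*.
  have /qP : T i i \in s by apply/rs/map_f; rewrite mem_enum.
  move=> /dvdpP[c /(congr1 (fun p => p.[T i i]))/eqP].
  rewrite !hornerE subrr expr0n /= mulr0 subr_eq0.
  by move/eqP.
have [tq dq] := trig_horner_diag q tT.
have [_ dTq] := trig_mul_diag tT tq.
have trT : \sum_i T i i * (T i i)^* = 0.
  apply: etrans (trA _ DD); rewrite -[A *m _](mulKmx uP) mxtrace_mulC -mulmxA.
  have -> : P *m (A *m horner_mx A q *m invmx P) = T *m horner_mx T q.
    by rewrite TE horner_mx_uconj // !mulmxA mulmxKV.
  by rewrite /mxtrace; apply: eq_bigr => i _; rewrite dTq dq q_diag.
have T0 i : T i i = 0.
  apply/eqP; rewrite -mul_conjC_eq0; apply/eqP.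
  by apply: (psumr_eq0P _ trT) => // j _; apply: mul_conjC_ge0.
move: chiA; rewrite /r big_map big_enum /=.
under eq_bigr => i _ do rewrite T0 subr0.
by rewrite prodr_const card_ord rmorphXn /= horner_mx_X.
Qed.

Section RealClosed.
Variable R : rcfType.
Local Notation C := (complex R).
Local Notation toC := (real_complex R).

(** Descent from the complex case: with real structure constants, the real and
the imaginary part of a complex derivation are real derivations. *)
Lemma derivation_mx_nilpotent_real n
    (E : 'I_n.+1 -> 'M[R]_n.+1) (A : 'M[R]_n.+1) :
  derivation_mx E A ->
  (forall D, derivation_mx E D -> \tr (A *m D) = 0) -> A ^+ n.+1 = 0.
Proof.
move=> DA trA; pose EC i := map_mx toC (E i).
(* [h] stands for the real part or the imaginary part. *)
have mapD (h : C -> R) : {morph h : x y / x + y} ->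
    (forall a z, h (toC a * z) = a * h z) -> h 0 = 0 ->
    forall D, derivation_mx EC D -> derivation_mx E (map_mx h D).
  move=> hD hZ h0 D DD i; apply/matrixP => j k.
  have h_sum (I : finType) (F : I -> C) : h (\sum_l F l) = \sum_l h (F l).
    exact: (big_morph h hD h0).
  have := congr1 (fun M : 'M_n.+1 => h (M j k)) (DD i).
  rewrite !mxE hD !h_sum summxE h_sum => e.
  have -> : \sum_l E i j l * map_mx h D l k = \sum_l h (EC i j l * D l k).
    by apply: eq_bigr => l _; rewrite !mxE hZ.
  rewrite e summxE; congr (_ + _); apply: eq_bigr => l _.
    by rewrite !mxE mulrC hZ mulrC.
  by rewrite !mxE mulrC hZ mulrC.
have DAC : derivation_mx EC (map_mx toC A).
  move=> i; rewrite -map_mxM DA map_mxD map_mxM raddf_sum; congr (_ + _).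
  by apply: eq_bigr => j _ /=; rewrite map_mxZ mxE.
apply/eqP; rewrite -(map_mx_eq0 toC) rmorphXn /=; apply/eqP.
apply: (derivation_mx_nilpotent DAC) => D DD.
have ReZ a (z : C) : complex.Re (toC a * z) = a * complex.Re z.
  by case: z => x y; rewrite /= mul0r subr0.
have ImZ a (z : C) : complex.Im (toC a * z) = a * complex.Im z.
  by case: z => x y; rewrite /= mul0r addr0.
have ReD : {morph (@complex.Re R : C -> R) : x y / x + y} by case=> ? ? [].
have ImD : {morph (@complex.Im R : C -> R) : x y / x + y} by case=> ? ? [].
have := trA _ (mapD _ ReD ReZ erefl _ DD).
have := trA _ (mapD _ ImD ImZ erefl _ DD).
have tr_map (h : C -> R) : {morph h : x y / x + y} ->
    (forall a z, h (toC a * z) = a * h z) -> h 0 = 0 ->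
    h (\tr (map_mx toC A *m D)) = \tr (A *m map_mx h D).
  move=> hD hZ h0; rewrite /mxtrace (big_morph h hD h0); apply: eq_bigr => i _.
  rewrite !mxE (big_morph h hD h0); apply: eq_bigr => j _.
  by rewrite !mxE hZ.
rewrite -!tr_map //; case: (\tr _) => x y /= -> ->; reflexivity.
Qed.

End RealClosed.

Lemma derivation_mx_iter_nilpotent (R : rcfType) n
    (E : 'I_n -> 'M[R]_n) (A : 'M[R]_n) :
  derivation_mx E A ->
  (forall D, derivation_mx E D -> \tr (A *m D) = 0) ->
  forall v : 'rV[R]_n, iter n (fun w => w *m A) v = 0.
Proof.
case: n E A => [|n] E A DA trA v; first by rewrite thinmx0.
have iterE k : iter k (fun w => w *m A) v = v *m A ^+ k.
  elim: k => [|k IHk] /=; first by rewrite expr0 mulmx1.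
  by rewrite IHk exprSr -mulmxE mulmxA.
by rewrite iterE (derivation_mx_nilpotent_real DA trA) mulmx0.
Qed.

(** * Lie algebras, derivations and traces *)

Lemma dual_separates (R : fieldType) (V : vectType R) (x y : V) :
  (forall h : dual V, h x = h y) -> x = y.
Proof.
move=> hxy; rewrite [x](coord_vbasis (memvf x)) [RHS](coord_vbasis (memvf y)).
apply: eq_bigr => i _; congr (_ *: _).
pose c : {linear V -> R^o} := HB.pack (fun z => coord (vbasis {:V}) i z)
  (GRing.isLinear.Build R V R^o _ (fun z => coord (vbasis {:V}) i z)
    (linearP (coord (vbasis {:V}) i))).
by have := hxy (linfun c); rewrite !lfunE.
Qed.


(** Decides identities between sums of vectors by applying an arbitrary linear
form and calling [ring] on the resulting scalars. *)
Ltac zmodule :=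
  apply: dual_separates => ?; rewrite !(linearD, linearN, linear0) /=; ring.

Section LieAlgebra.
Variables (R : fieldType) (L : lieAlgType R).
Implicit Types (x y z : L) (U V W : {vspace L}).

Lemma lieDl x y z : [lie x + y, z] = [lie x, z] + [lie y, z].
Proof. by have := lie_linearl z 1 x y; rewrite !scale1r. Qed.

Lemma lie0l z : [lie 0, z] = 0 :> L.
Proof. by rewrite lie_anti linear0 oppr0. Qed.

Lemma lieNl x z : [lie - x, z] = - [lie x, z].
Proof. by rewrite lie_anti linearN /= opprK lie_anti. Qed.

Lemma lieZl a x z : [lie a *: x, z] = a *: [lie x, z].
Proof. by have := lie_linearl z a x 0; rewrite /= lie0l !addr0. Qed.

Lemma lie_suml z (I : finType) (F : I -> L) :
  [lie \sum_i F i, z] = \sum_i [lie F i, z].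
Proof. exact: (big_morph (lie^~ z) (fun x y => lieDl x y z) (lie0l z)). Qed.

Lemma lie_lie x y z :
  [lie [lie x, y], z] = [lie x, [lie y, z]] - [lie y, [lie x, z]].
Proof.
have := lie_jacobi x y z; rewrite (lie_anti z [lie x, y]) (lie_anti z x).
by rewrite linearN /= => /eqP; rewrite subr_eq0 => /eqP <-.
Qed.

Lemma ad_linear : linear (@ad R L).
Proof.
by move=> a x y; apply/lfunP=> z; rewrite !(adE, lfun_simp) lieDl lieZl.
Qed.

HB.instance Definition _ :=
  GRing.isLinear.Build R L 'End(L) _ (@ad R L) ad_linear.

Lemma ad_lie x y : ad [lie x, y] = lfun_comm (ad x) (ad y).
Proof. by apply/lfunP=> z; rewrite !(adE, lfun_simp) lie_lie. Qed.

Definition derivation (D : 'End(L)) :=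
  forall x y, D [lie x, y] = [lie D x, y] + [lie x, D y].

Lemma ad_derivation x : derivation (ad x).
Proof. by move=> y z; rewrite !adE lie_lie subrK. Qed.

Lemma ad_of_derivation D x : derivation D -> ad (D x) = lfun_comm D (ad x).
Proof.
by move=> DD; apply/lfunP=> y; rewrite !(adE, lfun_simp) DD addrK.
Qed.

End LieAlgebra.

Section LfunTrace.
Variables (R : fieldType) (V : vectType R).
Implicit Types f g : 'End(V).

Definition lfun_trace f : R := \tr (f2mx f).

Lemma v2r_lfun f v : v2r (f v) = v2r v *m f2mx f.
Proof. by rewrite unlock /= r2vK. Qed.

Lemma f2mx_comp f g : f2mx (f \o g)%VF = f2mx g *m f2mx f.
Proof.
apply/row_matrixP => i; rewrite !rowE -[delta_mx 0 i]r2vK mulmxA -!v2r_lfun.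
by rewrite comp_lfunE.
Qed.

Lemma f2mx_linear a f g : f2mx (a *: f + g) = a *: f2mx f + f2mx g.
Proof.
apply/row_matrixP => i; rewrite !rowE mulmxDr -scalemxAr -[delta_mx 0 i]r2vK.
by rewrite -!v2r_lfun !lfun_simp linearP.
Qed.

Lemma lfun_trace_linear : linear_for *%R lfun_trace.
Proof. by move=> a f g; rewrite /lfun_trace f2mx_linear linearP. Qed.

HB.instance Definition _ :=
  GRing.isLinear.Build R 'End(V) R _ lfun_trace lfun_trace_linear.

Lemma lfun_trace_compC f g : lfun_trace (f \o g)%VF = lfun_trace (g \o f)%VF.
Proof. by rewrite /lfun_trace !f2mx_comp mxtrace_mulC. Qed.

Lemma lfun_trace_comm f g h :
  lfun_trace (lfun_comm f g \o h)%VF = lfun_trace (f \o lfun_comm g h)%VF.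
Proof.
rewrite /lfun_comm comp_lfunDl comp_lfunDr comp_lfunNl comp_lfunNr !linearB /=.
by rewrite !comp_lfunA -(comp_lfunA g f h) (lfun_trace_compC g).
Qed.

End LfunTrace.

Section StructureMatrices.
Variables (R : fieldType) (L : lieAlgType R).

Definition structure_mx (i : 'I_(dim L)) : 'M[R]_(dim L) :=
  f2mx (ad (r2v (delta_mx 0 i))).

Lemma v2r_lie (x y : L) :
  v2r [lie x, y] = mxprod structure_mx (v2r x) (v2r y).
Proof.
rewrite -[x in LHS]v2rK [v2r x in LHS]row_sum_delta linear_sum /= lie_suml.
rewrite linear_sum; apply: eq_bigr => i _ /=.
by rewrite !linearZ /= lieZl linearZ /= -adE v2r_lfun.
Qed.

Lemma derivation_f2mx (D : 'End(L)) :
  derivation D <-> derivation_mx structure_mx (f2mx D).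
Proof.
split=> [DD|/derivation_mxP DD x y].
  apply/derivation_mxP => u v.
  rewrite -[u]r2vK -[v]r2vK -!v2r_lfun -!v2r_lie -linearD /= -DD.
  by rewrite -v2r_lfun.
by apply: (can_inj v2rK); rewrite linearD /= !v2r_lie !v2r_lfun -DD v2r_lie.
Qed.

End StructureMatrices.

(** In coordinates, the derivations of L are the derivations of the algebra
given by its structure constants. *)
Lemma derivation_nilpotent (R : rcfType) (L : lieAlgType R) (A : 'End(L)) :
  derivation A ->
  (forall D, derivation D -> lfun_trace (A \o D)%VF = 0) ->
  exists N, forall x, iter N A x = 0.
Proof.
move=> DA trA; exists (dim L) => x; apply: (can_inj v2rK); rewrite linear0.
have -> k : v2r (iter k A x) = iter k (fun w => w *m f2mx A) (v2r x).
  by elim: k => //= k <-; rewrite v2r_lfun.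
apply: (derivation_mx_iter_nilpotent ((derivation_f2mx A).1 DA)) => D DD.
rewrite mxtrace_mulC -[D]/(f2mx (Hom D)) -f2mx_comp; apply: trA.
exact/derivation_f2mx.
Qed.

(** * Engel's theorem and the Killing form *)

Section Engel.
Variables (R : fieldType) (L : lieAlgType R).
Implicit Types (x y z : L) (K J U V W : {vspace L}).

Definition lie_stable K V := forall x y, x \in K -> y \in V -> [lie x, y] \in V.

(** Engel's conclusion for all quotients V / W at once: K has a nonzero
invariant vector in each nonzero one. Subspaces W are needed because the proof
applies the property to K acting on J / K. *)
Definition engel_property K := forall V W,
  lie_stable K V -> lie_stable K W -> ~~ (V <= W)%VS ->
  exists2 v, v \in V & v \notin W /\ forall x, x \in K -> [lie x, v] \in W.

Lemma engel_property0 : engel_property 0%VS.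
Proof.
move=> V W _ _ /subvPn[v Vv Wv]; exists v => //; split=> // x.
by rewrite memv0 => /eqP->; rewrite lie0l mem0v.
Qed.

(** The invariants of K in V / W are stable under v, which acts nilpotently; the
last nonzero iterate of v on one of them is invariant under v as well. *)
Lemma engel_property_step K v N :
  engel_property K -> lie_stable K K ->
  (forall x, x \in K -> [lie x, v] \in K) ->
  (forall x, iter N (lie v) x = 0) ->
  engel_property (K + <[v]>)%VS.
Proof.
move=> engelK KK Kv nilv V W KV KW VW.
have sK x : x \in K -> x \in (K + <[v]>)%VS.
  by apply/subvP; apply: addvSl.
have sv : v \in (K + <[v]>)%VS.
  by apply: (subvP (addvSr K <[v]>)); apply: memv_line.
have [|| u Vu [Wu Ku]] := engelK V W _ _ VW.
- by move=> x y Kx; apply: KV; apply: sK.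
- by move=> x y Kx; apply: KW; apply: sK.
have iterV k : iter k (lie v) u \in V.
  by elim: k => //= k IHk; apply: KV.
have iterW k x : x \in K -> [lie x, iter k (lie v) u] \in W.
  elim: k x => [|k IHk] x Kx /=; first exact: Ku.
  have -> : [lie x, [lie v, iter k (lie v) u]] =
      [lie [lie x, v], iter k (lie v) u] + [lie v, [lie x, iter k (lie v) u]].
    by rewrite lie_lie subrK.
  by apply: memvD; [apply/IHk/Kv | apply/KW/IHk].
have exW : exists k, iter k (lie v) u \in W by exists N; rewrite nilv mem0v.
case: (ex_minnP exW) => -[|k] Wk mink; first by rewrite Wk in Wu.
exists (iter k (lie v) u) => //; split.
  by apply/negP=> /mink; rewrite ltnn.
move=> _ /memv_addP[x Kx [_ /vlineP[a ->] ->]]; rewrite lieDl lieZl.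
by apply: memvD; [apply: iterW | apply/memvZ].
Qed.

(** Subalgebras with the Engel property are built one dimension at a time: the
property of K applied to J / K yields a v outside K that normalizes K. *)
Lemma engel J : lie_stable J J ->
  (forall x, x \in J -> exists N, forall y, iter N (lie x) y = 0) ->
  engel_property J.
Proof.
move=> JJ nilJ.
suff H m : (m <= \dim J)%N -> exists K,
    [/\ (K <= J)%VS, \dim K = m, lie_stable K K & engel_property K].
  have [K [sKJ dKJ _ engelK]] := H _ (leqnn _).
  by have /eqP <- : K == J by rewrite eqEdim sKJ dKJ /=.
elim: m => [|m IHm] m_lt.
  exists 0%VS; rewrite sub0v dimv0; split=> //; last exact: engel_property0.
  by move=> x y; rewrite memv0 => /eqP-> _; rewrite lie0l mem0v.
have [K [sKJ dK KK engelK]] := IHm (ltnW m_lt).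
have JK : ~~ (J <= K)%VS.
  by apply: contraL m_lt => /dimvS; rewrite dK -leqNgt.
have KJ : lie_stable K J by move=> x y /(subvP sKJ); apply: JJ.
have [v Jv [Kv vK]] := engelK J K KJ KK JK.
have [N nilv] := nilJ v Jv.
exists (K + <[v]>)%VS; split.
- by rewrite subv_add sKJ -memvE.
- rewrite dimv_disjoint_sum ?dK ?dim_vline; last first.
    apply/eqP; rewrite -subv0; apply/subvP=> x; rewrite memv_cap memv0.
    move=> /andP[Kx /vlineP[a xa]]; move: Kx; rewrite xa.
    by rewrite rpredZeq (negPf Kv) orbF => /eqP->; rewrite scale0r.
  have -> : v != 0 by apply: contraNneq Kv => ->; rewrite mem0v.
  by rewrite addn1.
- move=> _ w /memv_addP[x Kx [_ /vlineP[a ->] ->]].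
  move=> /memv_addP[y Ky [_ /vlineP[b ->] ->]].
  apply: (subvP (addvSl K <[v]>)).
  rewrite lieDl !linearD /= !lieZl !linearZ /= lie_alt !scaler0 addr0.
  rewrite (lie_anti v y).
  by do ?[exact: KK | exact: vK | apply: memvD | apply: memvZ | rewrite memvN].
- exact: (engel_property_step engelK KK vK nilv).
Qed.

End Engel.

Section Semisimple.
Variables (R : rcfType) (L : lieAlgType R).
Implicit Types (x y z : L).
Hypothesis ssL : semisimple L.

Lemma semisimple_abelian_ideal (I : {vspace L}) :
  lie_ideal I -> (forall x y, x \in I -> y \in I -> [lie x, y] = 0) -> I = 0%VS.
Proof.
move=> idI abI; apply: ssL => //; exists 1%N; apply/eqP.
by rewrite -subv0; apply/lie_prodvP=> x y Ix Iy; rewrite memv0 abI.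
Qed.

Lemma lie_prodv_ideal (I : {vspace L}) :
  lie_ideal I -> lie_ideal (lie_prodv I I).
Proof.
move=> idI x y; rewrite -adE memv_preim; apply/subvP/lie_prodvP => u v Iu Iv.
rewrite -memv_preim adE.
have -> : [lie x, [lie u, v]] = [lie [lie x, u], v] + [lie u, [lie x, v]].
  by rewrite lie_lie subrK.
have /lie_prodvP II := subvv (lie_prodv I I).
by rewrite memvD // II // idI.
Qed.

(** By Engel's theorem a nonzero J has a nonzero centre Z, an abelian ideal of
L. *)
Lemma nilpotent_ideal_eq0 (J : {vspace L}) : lie_ideal J ->
  (forall x, x \in J -> exists N, forall y, iter N (lie x) y = 0) -> J = 0%VS.
Proof.
move=> idJ nilJ.
have JJ : lie_stable J J by move=> x y _; apply: idJ.
pose Z := (J :&: \bigcap_(i < \dim J) lker (ad (vbasis J)`_i))%VS.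
have ZP z : reflect (z \in J /\ forall x, x \in J -> [lie x, z] = 0) (z \in Z).
  rewrite memv_cap; apply: (iffP andP) => -[Jz].
    move=> /subv_bigcapP zK; split=> // x /coord_vbasis->.
    rewrite lie_suml big1 // => i _; rewrite lieZl -adE.
    have := zK i isT; rewrite -memvE memv_ker => /eqP->.
    by rewrite scaler0.
  move=> zJ; split=> //; apply/subv_bigcapP => i _.
  rewrite -memvE memv_ker adE zJ // vbasis_mem // mem_nth //.
  by rewrite size_tuple.
have Z0 : Z = 0%VS.
  apply: semisimple_abelian_ideal.
    move=> x z /ZP[Jz zJ]; apply/ZP; split; first exact: idJ.
    move=> y Jy; have -> : [lie y, [lie x, z]] =
        [lie [lie y, x], z] + [lie x, [lie y, z]].
      by rewrite lie_lie subrK.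
    rewrite (zJ y) // linear0 addr0 zJ // lie_anti memvN; exact: idJ.
  by move=> x y /ZP[Jx _] /ZP[_]; apply.
apply/eqP; rewrite -subv0; apply/negPn/negP => Jn0.
have [|z Jz [/negP z0 zJ]] := engel JJ nilJ JJ _ Jn0.
  by move=> x y _; rewrite !memv0 => /eqP->; rewrite linear0.
apply: z0; rewrite -Z0; apply/ZP; split=> // x /zJ.
by rewrite memv0 => /eqP.
Qed.

End Semisimple.

Section Killing.
Variables (R : fieldType) (L : lieAlgType R).
Implicit Types (x y z : L).

Definition killing x y : R := lfun_trace (ad x \o ad y)%VF.

Lemma killingC x y : killing x y = killing y x.
Proof. exact: lfun_trace_compC. Qed.

Lemma killing_linearr x : linear_for *%R (killing x).
Proof.
by move=> a y z; rewrite /killing linearP comp_lfunDr -comp_lfunZr linearP.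
Qed.

Lemma killing_lie x y z : killing [lie x, y] z = killing x [lie y, z].
Proof. by rewrite /killing !ad_lie lfun_trace_comm. Qed.

Definition killing_dual x : dual L :=
  linfun (HB.pack (killing x : L -> R^o)
    (GRing.isLinear.Build R L R^o _ (killing x) (killing_linearr x))
    : {linear L -> R^o}).

Lemma killing_dualE x y : killing_dual x y = killing x y.
Proof. exact: lfunE. Qed.

Lemma killing_dual_linear : linear killing_dual.
Proof.
move=> a x y; apply/lfunP => z; rewrite add_lfunE scale_lfunE !killing_dualE.
by rewrite !(killingC _ z) killing_linearr.
Qed.

Definition killing_map : 'Hom(L, dual L) :=
  linfun (HB.pack killing_dual
    (GRing.isLinear.Build R L (dual L) _ killing_dual killing_dual_linear)
    : {linear L -> dual L}).

Lemma killing_mapE x y : killing_map x y = killing x y.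
Proof. by rewrite /killing_map lfunE /= killing_dualE. Qed.

Lemma killingNl x y : killing (- x) y = - killing x y.
Proof. by rewrite -!killing_mapE linearN opp_lfunE. Qed.

(** This is tr ([ad a, ad b] D) = tr (ad a [ad b, D]), where [ad b, D] is the
inner derivation - ad (D b). *)
Lemma trace_commutator_derivation a b (D : 'End(L)) : derivation D ->
  (forall y, killing a y = 0) -> lfun_trace (ad [lie a, b] \o D)%VF = 0.
Proof.
move=> DD ka; rewrite ad_lie lfun_trace_comm.
have -> : lfun_comm (ad b) D = - ad (D b).
  by rewrite (ad_of_derivation _ DD) /lfun_comm opprB.
by rewrite comp_lfunNr linearN /= -/(killing a (D b)) ka oppr0.
Qed.

End Killing.

(** Cartan's criterion, for the radical I of the Killing form: [I, I] consists
of ad-nilpotent elements, hence vanishes, and then I is abelian. *)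
Lemma semisimple_killing (R : rcfType) (L : lieAlgType R) : semisimple L ->
  lker (killing_map L) == 0%VS.
Proof.
move=> ssL; set I := lker _.
have IP x : reflect (forall y, killing x y = 0) (x \in I).
  rewrite memv_ker; apply: (iffP eqP) => [kx y|kx].
    by rewrite -killing_mapE kx lfunE.
  by apply/lfunP=> y; rewrite killing_mapE kx lfunE.
have idI : lie_ideal I.
  move=> x y /IP ky; apply/IP => z.
  by rewrite lie_anti killingNl killing_lie ky oppr0.
apply/eqP/(semisimple_abelian_ideal ssL idI) => x y Ix Iy; apply/eqP.
rewrite -memv0 -(nilpotent_ideal_eq0 ssL (lie_prodv_ideal idI)).
  by have /lie_prodvP := subvv (lie_prodv I I); apply.
move=> {x y Ix Iy} x Jx.
have [|N nilx] := derivation_nilpotent (ad_derivation x).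
  move=> D DD.
  have linD : linear (fun y : L => lfun_trace (ad y \o D)%VF : R^o).
    by move=> a y z; rewrite linearP comp_lfunDl -comp_lfunZl linearP.
  pose t := linfun (HB.pack (fun y : L => lfun_trace (ad y \o D)%VF : R^o)
    (GRing.isLinear.Build R L R^o _ _ linD) : {linear L -> R^o}).
  suff : x \in lker t by rewrite memv_ker /t lfunE => /eqP.
  apply: subvP Jx; apply/lie_prodvP => a b /IP ka _.
  by rewrite memv_ker /t lfunE /= trace_commutator_derivation.
exists N => y; rewrite -[RHS](nilx y).
by elim: N {nilx} => //= k ->; rewrite adE.
Qed.

(** * Prederivations of perfect Lie algebras with trivial centre *)

Section Perfect.
Variables (R : fieldType) (L : lieAlgType R).

Definition perfect := lie_prodv {:L} {:L} = {:L}%VS.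
Definition centerless := forall x : L, (forall y, [lie x, y] = 0) -> x = 0.

Lemma centerless_eq (x y : L) : centerless ->
  (forall z, [lie x, z] = [lie y, z]) -> x = y.
Proof.
move=> zL xy; apply/eqP; rewrite -subr_eq0; apply/eqP; apply: zL => z.
by rewrite lieDl lieNl xy subrr.
Qed.

Lemma perfect_hom_eq0 (V : vectType R) (f : 'Hom(L, V)) : perfect ->
  (forall x y, f [lie x, y] = 0) -> f = 0.
Proof.
move=> pL f0; apply/lfunP=> x; apply/eqP; rewrite lfunE /= -memv_ker.
apply: (subvP _ _ (memvf x)); rewrite -pL; apply/lie_prodvP => y z _ _.
by rewrite memv_ker f0.
Qed.

(** A proper subspace is annihilated by some nonzero linear form. *)
Lemma perfect_of_dual :
  (forall f : dual L, (forall x y, f [lie x, y] = 0) -> f = 0) -> perfect.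
Proof.
move=> f0; apply/eqP; rewrite eqEsubv subvf /=; apply/subvP=> x _.
set P := lie_prodv _ _.
suff <- : projv P x = x by apply: memv_proj.
apply: dual_separates => h; apply/eqP; rewrite -subr_eq0 -linearB /=; apply/eqP.
have -> : projv P x - x = (projv P - \1)%VF x by rewrite !lfun_simp.
rewrite -comp_lfunE (f0 (h \o (projv P - \1))%VF) ?lfunE // => y z.
have Pyz : [lie y, z] \in P.
  by have /lie_prodvP := subvv P; apply; rewrite memvf.
by rewrite !lfun_simp projv_id // subrr linear0.
Qed.

End Perfect.

(** For w = [x, y] the prederivation identity shows that [phi, ad w] is the
inner derivation of [phi x, y] + [x, phi y]. By perfectness [phi, ad w] is inner
for every w, equal to ad (delta w) for a derivation delta; the three formulas
for phi [w, z] and delta [w, z] then give 2 [phi w - delta w, z] = 0. *)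
Lemma prederivation_derivation (R : numFieldType) (L : lieAlgType R)
    (phi : 'End(L)) :
  perfect L -> centerless L -> prederivation phi -> derivation phi.
Proof.
move=> pL zL pphi.
have phi_lin : linear (fun w => lfun_comm phi (ad w)).
  move=> a x y; rewrite /lfun_comm linearP comp_lfunDl comp_lfunDr.
  by rewrite -comp_lfunZl -comp_lfunZr scalerBr opprD addrACA.
pose Phi := linfun (HB.pack (fun w => lfun_comm phi (ad w))
  (GRing.isLinear.Build R L 'End(L) _ _ phi_lin) : {linear L -> 'End(L)}).
have PhiE w : Phi w = lfun_comm phi (ad w) by rewrite /Phi lfunE.
pose adh := linfun (@ad R L : {linear L -> 'End(L)}).
have adhE w : adh w = ad w by rewrite /adh lfunE.
pose delta := (adh^-1 \o Phi)%VF.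
have phi_ad x y z : phi [lie [lie x, y], z] - [lie [lie x, y], phi z] =
    [lie [lie phi x, y] + [lie x, phi y], z].
  rewrite !lie_lie linearB /= !pphi lieDl !lie_lie; zmodule.
have inner w : adh (delta w) = Phi w.
  rewrite /delta comp_lfunE limg_lfunVK // memv_preim.
  apply: (subvP _ _ (memvf w)); rewrite -[X in (X <= _)%VS]pL.
  apply/lie_prodvP => x y _ _; rewrite -memv_preim.
  suff -> : Phi [lie x, y] = adh ([lie phi x, y] + [lie x, phi y]).
    by rewrite memv_img // memvf.
  apply/lfunP => z; rewrite PhiE adhE !(adE, lfun_simp); exact: phi_ad.
have phi_lie w z : phi [lie w, z] = [lie delta w, z] + [lie w, phi z].
  have := congr1 (fun f : 'End(L) => f z) (inner w).
  by rewrite adhE PhiE !(adE, lfun_simp) => ->; rewrite subrK.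
have center_eq x y := @centerless_eq _ L x y zL.
have delta_phi x y : delta [lie x, y] = [lie phi x, y] + [lie x, phi y].
  by apply: center_eq => z; rewrite -phi_ad phi_lie addrK.
have delta_der x y : delta [lie x, y] = [lie delta x, y] + [lie x, delta y].
  apply: center_eq => z; apply: (addIr [lie [lie x, y], phi z]).
  rewrite -phi_lie lieDl !lie_lie linearB /= !phi_lie !linearD /=; zmodule.
suff phi_delta : phi = delta by rewrite phi_delta; exact: delta_der.
apply/lfunP => x; apply: center_eq => y; apply/eqP; rewrite -subr_eq0.
have e1 : [lie phi x, y] + [lie x, phi y] = [lie delta x, y] + [lie x, delta y].
  by rewrite -delta_phi delta_der.
have e2 : [lie delta x, y] + [lie x, phi y] = [lie phi x, y] + [lie x, delta y].
  by rewrite -phi_lie lie_anti linearN /= phi_lie opprD -!lie_anti addrC.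
have {e1 e2} : ([lie phi x, y] - [lie delta x, y]) *+ 2 = 0.
  apply: etrans (subrr ([lie phi x, y] + [lie x, phi y]
                        - ([lie delta x, y] + [lie x, phi y]))).
  rewrite {2}e1 {2}e2 mulr2n; zmodule.
by move/eqP; rewrite -scaler_nat scaler_eq0 pnatr_eq0.
Qed.

(** * Lie algebras with nondegenerate Killing form *)

Lemma lker0_dual_lfunVK (R : fieldType) (V : vectType R) (t : 'Hom(V, dual V)) :
  lker t == 0%VS -> cancel t^-1%VF t.
Proof.
move=> t0 f; apply: limg_lfunVK.
suff -> : limg t = fullv by rewrite memvf.
apply/eqP; rewrite eqEdim subvf /= limg_dim_eq ?(eqP t0) ?capv0 //.
by rewrite !dimvf -[X in (X <= _)%N]/(dim V * 1)%N muln1.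
Qed.

Section KillingNondegenerate.
Variables (R : fieldType) (L : lieAlgType R).
Hypothesis killing0 : lker (killing_map L) == 0%VS.
Local Notation kappa := (killing_map L).

Lemma killing_nondeg (x : L) : (forall y, killing x y = 0) -> x = 0.
Proof.
move=> kx; apply/eqP; rewrite -memv0 -(eqP killing0) memv_ker.
apply/eqP/lfunP=> y.
by rewrite killing_mapE kx lfunE.
Qed.

Lemma killing_map_invK : cancel kappa^-1%VF kappa.
Proof. exact: lker0_dual_lfunVK. Qed.

Lemma killing_centerless : centerless L.
Proof.
move=> x zx; apply: killing_nondeg => y; rewrite /killing.
have -> : ad x = 0 by apply/lfunP=> z; rewrite adE zx lfunE.
by rewrite comp_lfun0l linear0.
Qed.

(** A linear form vanishing on brackets is represented by a central element. *)
Lemma killing_perfect : perfect L.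
Proof.
apply: perfect_of_dual => f f0; rewrite -(killing_map_invK f).
rewrite [X in kappa X](_ : _ = 0) ?linear0 //.
apply: killing_centerless => x; apply: killing_nondeg => y.
by rewrite killing_lie -killing_mapE killing_map_invK f0.
Qed.

(** Let d represent the linear form x |-> tr (D ad x). Then E = D - ad d is a
derivation with tr (E ad x) = 0 for all x, and the Killing form of E x and y is
tr (E ad [x, y]) = 0. *)
Lemma killing_derivation_inner D : derivation D -> exists d : L, D = ad d.
Proof.
move=> DD.
have tl : linear (fun x : L => lfun_trace (D \o ad x)%VF : R^o).
  by move=> a x y; rewrite linearP comp_lfunDr -comp_lfunZr linearP.
pose t : dual L := linfun (HB.pack
  (fun x : L => lfun_trace (D \o ad x)%VF : R^o)
  (GRing.isLinear.Build R L R^o _ _ tl) : {linear L -> R^o}).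
pose d := (kappa^-1%VF) t; exists d.
have td x : lfun_trace (D \o ad x)%VF = killing d x.
  by rewrite -killing_mapE killing_map_invK /t lfunE.
apply/eqP; rewrite -subr_eq0; apply/eqP/lfunP => x; rewrite [RHS]lfunE /=.
set E := D - ad d.
have DE : derivation E.
  move=> u v; rewrite /E !(add_lfunE, opp_lfunE) DD ad_derivation.
  by rewrite lieDl lieNl linearB /= opprD addrACA.
apply: killing_nondeg => y.
rewrite /killing (ad_of_derivation _ DE) lfun_trace_comm -ad_lie.
by rewrite /E comp_lfunDl comp_lfunNl linearB /= td subrr.
Qed.

Lemma killing_map_ad x y : kappa [lie x, y] = coad x (kappa y).
Proof.
apply/lfunP=> z; rewrite coad_apply !killing_mapE.
by rewrite lie_anti killingNl killing_lie.
Qed.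

End KillingNondegenerate.

(** * The two summands of the cotangent Lie algebra *)

Section Cotangent.
Variables (R : fieldType) (g : lieAlgType R).
Implicit Types (x y : g) (f h : dual g).

Definition base x : cotangent g := (x, 0).
Definition fibre f : cotangent g := (0, f).

Lemma coad0l f : coad (0 : g) f = 0.
Proof. by apply/lfunP=> y; rewrite coad_apply lie0l linear0 oppr0 lfunE. Qed.

Lemma cotangent_lieE x y f h :
  [lie (x, f) : cotangent g, (y, h)] = ([lie x, y], coad x h - coad y f).
Proof. by []. Qed.

Lemma lie_base x y : [lie base x, base y] = base [lie x, y].
Proof. by rewrite /base cotangent_lieE !linear0 addr0. Qed.

Lemma lie_base_fibre x f : [lie base x, fibre f] = fibre (coad x f).
Proof. by rewrite /base /fibre cotangent_lieE !linear0 addr0. Qed.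

Lemma lie_fibre f h : [lie fibre f, fibre h] = 0.
Proof. by rewrite /fibre cotangent_lieE lie0l !coad0l subrr. Qed.

Lemma cotangentE x f : ((x, f) : cotangent g) = base x + fibre f.
Proof. by congr (_, _); rewrite /= ?addr0 ?add0r. Qed.


Lemma base_linear : linear base.
Proof. by move=> a x y; congr (_, _); rewrite /= scaler0 addr0. Qed.

HB.instance Definition _ :=
  GRing.isLinear.Build R g (cotangent g) _ base base_linear.

Lemma fibre_linear : linear fibre.
Proof. by move=> a x y; congr (_, _); rewrite /= scaler0 addr0. Qed.

HB.instance Definition _ :=
  GRing.isLinear.Build R (dual g) (cotangent g) _ fibre fibre_linear.

Lemma fst_linear : linear (fst : cotangent g -> g). Proof. by []. Qed.

HB.instance Definition _ :=
  GRing.isLinear.Build R (cotangent g) g _ fst fst_linear.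

Lemma snd_linear : linear (snd : cotangent g -> dual g). Proof. by []. Qed.

HB.instance Definition _ :=
  GRing.isLinear.Build R (cotangent g) (dual g) _ snd snd_linear.

End Cotangent.

Section CotangentOfKillingNondegenerate.
Variables (R : fieldType) (g : lieAlgType R).
Hypothesis killing0 : lker (killing_map g) == 0%VS.
Local Notation kappa := (killing_map g).

Let kappaK := killing_map_invK killing0.

(** Besides g = [g, g], the Killing form gives [g, g^*] = g^* because it
identifies ad^* with ad. *)
Lemma cotangent_perfect : perfect (cotangent g).
Proof.
apply: perfect_of_dual => F F0.
have pg := killing_perfect killing0.
have Fb : (F \o linfun (@base R g))%VF = 0.
  by apply: perfect_hom_eq0 => // x y; rewrite comp_lfunE lfunE /= -lie_base F0.
have Ff : (F \o linfun (@fibre R g) \o kappa)%VF = 0.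
  apply: perfect_hom_eq0 => // x y.
  by rewrite !comp_lfunE lfunE /= killing_map_ad -lie_base_fibre F0.
apply/lfunP => -[x f]; rewrite cotangentE linearD /=.
have -> : F (base x) = 0 by have /lfunP/(_ x) := Fb; rewrite comp_lfunE !lfunE.
have /lfunP/(_ (kappa^-1%VF f)) := Ff.
rewrite !comp_lfunE kappaK !lfunE /= => ->.
by rewrite addr0.
Qed.

Lemma cotangent_centerless : centerless (cotangent g).
Proof.
have zg := killing_centerless killing0.
move=> [x f] zx; have x0 : x = 0.
  by apply: zg => y; have [] := zx (base y).
congr (_, _) => //; rewrite -(kappaK f) [X in kappa X](_ : _ = 0) ?linear0 //.
apply: zg => y.
have : fibre (coad y f) = 0.
  by rewrite -lie_base_fibre lie_anti -[fibre f]/(0, f) -x0 zx oppr0.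
rewrite -{1}(kappaK f) -killing_map_ad => -[ky].
rewrite lie_anti; apply/eqP; rewrite oppr_eq0 -memv0 -(eqP killing0) memv_ker.
by rewrite ky.
Qed.

End CotangentOfKillingNondegenerate.

(** * Skew-symmetric derivations of the cotangent Lie algebra *)

Section Components.
Variables (R : fieldType) (g : lieAlgType R) (phi : 'End(cotangent g)).

Definition fst_lfun : 'Hom(cotangent g, g) :=
  linfun (fst : {linear cotangent g -> g}).
Definition snd_lfun : 'Hom(cotangent g, dual g) :=
  linfun (snd : {linear cotangent g -> dual g}).

Definition base_base : 'End(g) := (fst_lfun \o phi \o linfun (@base R g))%VF.
Definition base_fibre : 'Hom(g, dual g) :=
  (snd_lfun \o phi \o linfun (@base R g))%VF.
Definition fibre_base : 'Hom(dual g, g) :=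
  (fst_lfun \o phi \o linfun (@fibre R g))%VF.
Definition fibre_fibre : 'End(dual g) :=
  (snd_lfun \o phi \o linfun (@fibre R g))%VF.

Lemma lfun_baseE x : phi (base x) = (base_base x, base_fibre x).
Proof.
by rewrite /base_base /base_fibre !comp_lfunE !lfunE /=; case: (phi _).
Qed.

Lemma lfun_fibreE f : phi (fibre f) = (fibre_base f, fibre_fibre f).
Proof.
by rewrite /fibre_base /fibre_fibre !comp_lfunE !lfunE /=; case: (phi _).
Qed.

End Components.

Section SkewDerivation.
Variables (R : numFieldType) (g : lieAlgType R).
Hypothesis killing0 : lker (killing_map g) == 0%VS.
Local Notation kappa := (killing_map g).

Let kappaK := killing_map_invK killing0.
Let kappa_invK : cancel kappa (kappa^-1)%VF := lker0_lfunK killing0.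

(** The g-block of phi is a derivation of g, hence some ad d. The block g -> g^*
is a cocycle; the Killing form turns it into a derivation ad e of g, which makes
it the action of the element (0, kappa e) of g^*. *)
Lemma derivation_inner_on_base (phi : 'End(cotangent g)) : derivation phi ->
  exists u, forall x, phi (base x) = [lie u, base x].
Proof.
move=> Dphi.
have Dbase x y := Dphi (base x) (base y).
have [d dE] : exists d, base_base phi = ad d.
  apply: killing_derivation_inner => // x y.
  by have := Dbase x y; rewrite lie_base !lfun_baseE => -[].
have [e eE] : exists e, (kappa^-1 \o base_fibre phi)%VF = ad e.
  apply: killing_derivation_inner => // x y.
  apply: (can_inj kappa_invK); rewrite linearD /=.
  rewrite (lie_anti (fun_of_lfun _ x)) linearN /= !killing_map_ad.
  rewrite !(comp_lfunE (kappa^-1)%VF) !kappaK.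
  have := Dbase x y; rewrite lie_base !lfun_baseE => -[_ ->].
  by rewrite !linear0 addr0 add0r addrC.
exists (d, kappa e) => x.
rewrite lfun_baseE dE adE cotangent_lieE linear0 add0r.
congr (_, _); rewrite -killing_map_ad -linearN -lie_anti -adE -eE.
by rewrite (comp_lfunE (kappa^-1)%VF) /= kappaK.
Qed.

(** Transported to g by the Killing form, the block g^* -> g becomes an
endomorphism p commuting with ad. As g^* is abelian, [p x, y] + [x, p y] = 0
also holds, so 2 p [x, y] = 0. *)
Lemma derivation_fibre (phi : 'End(cotangent g)) : derivation phi ->
  (forall x, phi (base x) = 0) ->
  forall f, phi (fibre f) = fibre (fibre_fibre phi f).
Proof.
move=> Dphi phi0.
pose p := (fibre_base phi \o kappa)%VF.
have p_ad x y : p [lie x, y] = [lie x, p y].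
  have := Dphi (base x) (fibre (kappa y)).
  rewrite phi0 lie0l add0r lie_base_fibre -killing_map_ad !lfun_fibreE => -[].
  by rewrite /p !(comp_lfunE _ kappa).
have p_skew x y : [lie p x, y] + [lie x, p y] = 0.
  have := Dphi (fibre (kappa x)) (fibre (kappa y)).
  rewrite lie_fibre linear0 !lfun_fibreE !cotangent_lieE => -[_].
  rewrite !coad0l subr0 sub0r -!killing_map_ad -linearN -linearD /=.
  rewrite -!comp_lfunE.
  rewrite -lie_anti => k0; apply/eqP; rewrite -memv0 -(eqP killing0) memv_ker.
  by rewrite -k0.
have p0 : p = 0.
  apply: (perfect_hom_eq0 (killing_perfect killing0)) => x y; apply/eqP.
  have := p_skew x y; rewrite -p_ad lie_anti -p_ad -linearN -lie_anti.
  by rewrite -mulr2n => /eqP; rewrite -scaler_nat scaler_eq0 pnatr_eq0.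
move=> f; rewrite lfun_fibreE -[f in fibre_base _ f]kappaK -comp_lfunE -/p p0.
by rewrite lfunE.
Qed.

(** By invariance g^* = [g, g^*] is totally isotropic for B. Skew-symmetry makes
the image of g^* under phi orthogonal to g too, so this image lies in the
radical of B. *)
Lemma skew_derivation_base0 (B : {symmetric (cotangent g)}) phi :
  orthogonal_structure B -> derivation phi -> skew_for B phi ->
  (forall x, phi (base x) = 0) -> phi = 0.
Proof.
move=> [nB invB] Dphi skphi phi0.
have pg := killing_perfect killing0.
have B_fibre f h : B (fibre f) (fibre h) = 0.
  have Bl : linear (B (fibre f) : cotangent g -> R^o).
    by move=> a u v; rewrite linearPr.
  pose b : dual (cotangent g) :=
    linfun (HB.pack (B (fibre f) : cotangent g -> R^o)
      (GRing.isLinear.Build R (cotangent g) R^o _ _ Bl)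
      : {linear cotangent g -> R^o}).
  have bE k : (b \o linfun (@fibre R g))%VF k = B (fibre f) (fibre k).
    by rewrite comp_lfunE !lfunE.
  have b0 : (b \o linfun (@fibre R g) \o kappa)%VF = 0.
    apply: perfect_hom_eq0 => // x y.
    rewrite (comp_lfunE _ kappa) bE killing_map_ad -lie_base_fibre.
    have := invB (fibre f) (base x) (fibre (kappa y)).
    rewrite lie_fibre linear0r addr0 lie_anti linearNl => /eqP.
    rewrite oppr_eq0 => /eqP B0.
    by have := invB (base x) (fibre f) (fibre (kappa y)); rewrite B0 add0r.
  have /lfunP/(_ (kappa^-1%VF h)) := b0.
  by rewrite (comp_lfunE _ kappa) bE kappaK lfunE.
have radB u : (forall v, B u v = 0) -> u = 0.
  move=> Bu; apply/eqP; rewrite -memv0 -(eqP nB); apply/mem_orthovP => v _.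
  exact: Bu.
apply/lfunP => -[x f]; rewrite cotangentE linearD /= phi0 add0r lfunE /=.
apply: radB => -[y h]; rewrite cotangentE linearDr /=.
have phif := derivation_fibre Dphi phi0 f.
rewrite [X in _ + B X _]phif B_fibre addr0.
have := skphi (fibre f) (base y); rewrite phi0.
by rewrite linear0r addr0.
Qed.

Lemma skew_derivation_inner (B : {symmetric (cotangent g)}) phi :
  orthogonal_structure B -> derivation phi -> skew_for B phi ->
  inner_derivation phi.
Proof.
move=> oB Dphi skphi; have [u phiu] := derivation_inner_on_base Dphi.
exists u; apply/eqP; rewrite -subr_eq0; apply/eqP.
apply: (skew_derivation_base0 oB) => [v w|v w|x].
- rewrite !(add_lfunE, opp_lfunE) Dphi ad_derivation.
  by rewrite lieDl lieNl linearB /= opprD addrACA.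
- rewrite !(add_lfunE, opp_lfunE) linearDl linearDr linearNl linearNr addrACA.
  by rewrite skphi !adE -opprD oB.2 oppr0 addr0.
- by rewrite !(add_lfunE, opp_lfunE) adE phiu subrr.
Qed.

End SkewDerivation.

Lemma semisimple_skew_prederivation_inner (R : rcfType) (g : lieAlgType R)
    (B : {symmetric (cotangent g)}) (phi : 'End(cotangent g)) :
  semisimple g -> orthogonal_structure B -> prederivation phi ->
  skew_for B phi ->
  inner_derivation phi.
Proof.
move=> /semisimple_killing killing0 oB pphi skphi.
apply: (skew_derivation_inner killing0 oB) => //.
apply: prederivation_derivation pphi; first exact: cotangent_perfect.
exact: cotangent_centerless.
Qed.

(** * Block form of skew-symmetric prederivations *)

Section SkewPrederivation.
Variables (R : fieldType) (g : lieAlgType R) (phi : 'End(cotangent g)).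
Variables (alpha : 'End(g)) (beta : 'Hom(g, dual g)).
Variables (psi : 'Hom(dual g, g)) (xi : 'End(dual g)).
Hypothesis phi_base : forall x, phi (base x) = (alpha x, beta x).
Hypothesis phi_fibre : forall f, phi (fibre f) = (psi f, xi f).

(** The endomorphism j' of g with transpose xi + alpha^t, obtained through the
identification of g with its bidual. *)
Definition shifted_transpose : 'End(g) :=
  (tr_dual (xi + tr alpha) \o bidual g)%VF.

Lemma shifted_transposeE (f : dual g) x :
  f (shifted_transpose x) = xi f x + f (alpha x).
Proof.
rewrite /shifted_transpose comp_lfunE tr_dualE bidualE !add_lfunE trE.
by rewrite comp_lfunE.
Qed.

Lemma tr_shifted_transpose (f : dual g) :
  (tr shifted_transpose - tr alpha) f = xi f.
Proof.
apply/lfunP => x; rewrite !(add_lfunE, opp_lfunE) !trE !(comp_lfunE f).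
by rewrite shifted_transposeE addrK.
Qed.

Hypothesis pphi : prederivation phi.

Lemma prederivation_base_base : prederivation alpha.
Proof.
move=> x y z; have := pphi (base x) (base y) (base z).
by rewrite !lie_base !phi_base => -[].
Qed.

Lemma prederivation_base_fibre x y z :
  beta [lie x, [lie y, z]] = - coad [lie y, z] (beta x)
                  + coad x (coad y (beta z) - coad z (beta y)).
Proof.
have := pphi (base x) (base y) (base z); rewrite !lie_base !phi_base => -[_ ->].
by rewrite !linear0 !addr0 !add0r; zmodule.
Qed.

Lemma prederivation_fibre_base x y :
  (psi \o coad x \o coad y = ad x \o ad y \o psi)%VF.
Proof.
apply/lfunP => f; rewrite !comp_lfunE !adE.
have := pphi (base x) (base y) (fibre f).
rewrite !lie_base_fibre phi_base !phi_fibre => -[-> _].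
by rewrite !linear0 !add0r.
Qed.

Lemma prederivation_fibre_fibre x y f : xi (coad x (coad y f)) =
  coad (alpha x) (coad y f) + coad x (coad (alpha y) f)
    + coad x (coad y (xi f)).
Proof.
have := pphi (base x) (base y) (fibre f).
rewrite !lie_base_fibre !phi_base !phi_fibre => -[_ ->].
by rewrite !coad0l !linear0 !addr0.
Qed.

Lemma prederivation_fibre_skew x f h :
  coad x (coad (psi f) h - coad (psi h) f) = 0.
Proof.
have := pphi (base x) (fibre f) (fibre h).
rewrite lie_fibre !linear0 !phi_fibre => -[_].
rewrite !coad0l !subr0 !sub0r !add0r => ->.
by rewrite !linear0 !addr0; zmodule.
Qed.

(** Adding to the identity for xi on ad^*_x ad^*_y f the prederivation identity
of alpha on [y, [x, z]] cancels all terms in which alpha acts inside a bracket.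
The order of x and y is reversed by transposition. *)
Lemma precentroid_shifted_transpose : precentroid shifted_transpose.
Proof.
move: shifted_transpose shifted_transposeE => j jE y x.
apply/lfunP => z; apply: dual_separates => f.
have coad2 k w : coad x (coad y k) w = k [lie y, [lie x, w]].
  by rewrite !coad_apply opprK.
rewrite /lfun_comm add_lfunE opp_lfunE !comp_lfunE zero_lfunE linear0.
rewrite linearB /=.
rewrite !adE -coad2 !jE prederivation_fibre_fibre.
rewrite prederivation_base_base !add_lfunE !coad2 !coad_apply !opprK.
rewrite !linearD /=; ring.
Qed.

End SkewPrederivation.

Lemma skew_prederivation_form (R : fieldType) (g : lieAlgType R)
    (muD : {symmetric (cotangent g)})
    (j11 : 'End(g)) (j12 : 'Hom(g, dual g)) (j21 : 'Hom(dual g, g)) :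
  (forall x y : g, j12 x y = j12 y x) ->
  (forall f h : dual g, h (j21 f) = f (j21 h)) ->
  (forall (x y : g) (f h : dual g),
    muD (x, f) (y, h) = h (j11 x) + f (j11 y) + h (j21 f) + j12 x y) ->
  forall phi : 'End(cotangent g),
  prederivation phi -> skew_for muD phi ->
  exists (j' alpha : 'End(g)) (beta : 'Hom(g, dual g))
         (psi : 'Hom(dual g, g)),
    [/\ precentroid j', prederivation alpha,
        forall (x : g) (f : dual g),
          phi (x, f) = (alpha x + psi f, beta x + (tr j' - tr alpha) f),
        [/\ forall x y z : g,
              beta [lie x, [lie y, z]] =
                - coad [lie y, z] (beta x)
                + coad x (coad y (beta z) - coad z (beta y)),
            forall x y : g,
              (psi \o coad x \o coad y = ad x \o ad y \o psi)%VF
          & forall (x : g) (f h : dual g),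
              coad x (coad (psi f) h - coad (psi h) f) = 0]
      & [/\ forall x y : g,
              beta x (j11 y) + beta y (j11 x)
              + j12 (alpha x) y + j12 (alpha y) x = 0,
            forall f h : dual g,
              f (j11 (psi h)) + h (j11 (psi f))
              + f (j' (j21 h)) + h (j' (j21 f))
              - f (alpha (j21 h)) - h (alpha (j21 f)) = 0
          & lfun_comm j11 alpha + (j21 \o beta)%VF + (j' \o j11)%VF
              + (tr_dual psi \o j12)%VF = 0]].
Proof.
move=> j12C j21C muDE phi pphi skphi.
have := @lfun_baseE _ _ phi; have := @lfun_fibreE _ _ phi.
move: (base_base phi) (base_fibre phi) (fibre_base phi) (fibre_fibre phi).
move=> alpha beta psi xi phif phib.
have j'E := shifted_transposeE alpha xi.
have trj := tr_shifted_transpose alpha xi.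
have pj := precentroid_shifted_transpose phib phif pphi.
move: (shifted_transpose alpha xi) j'E trj pj => j' j'E trj pj.
exists j', alpha, beta, psi; split=> //.
- exact: (prederivation_base_base phib).
- by move=> x f; rewrite trj cotangentE linearD /= phib phif.
- split=> [x y z|x y|x f h].
  + exact: (prederivation_base_fibre phib pphi).
  + exact: (prederivation_fibre_base phib phif pphi).
  + exact: (prederivation_fibre_skew phif pphi).
split=> [x y|f h|].
- have := skphi (base x) (base y); rewrite !phib !muDE !lfunE /=.
  rewrite !add0r !linear0 !addr0 (j12C x) => <-; ring.
- have := skphi (fibre f) (fibre h); rewrite !phif !muDE !linear0 !lfunE /=.
  rewrite (j21C (xi f) h) !j'E => <-; ring.
move: (tr_dual psi) (tr_dualE psi) => psit psitE.
apply/lfunP => x; apply: dual_separates => h.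
have := skphi (base x) (fibre h); rewrite phib phif !muDE.
rewrite /lfun_comm !(add_lfunE, opp_lfunE, comp_lfunE, zero_lfunE) !linear0.
rewrite !linearD !linearN /= j'E psitE => <-; ring.
Qed.

(** This is [skew_prederivation_form] for j12 = theta j1 and j21 = j2 theta^-1,
transported by theta, which intertwines ad and ad^*: alpha2 = theta^-1 beta and
j1' = psi theta. *)
Lemma skew_prederivation_form_orthogonal (R : fieldType) (g : lieAlgType R)
    (mu : {symmetric g}) (theta : 'Hom(g, dual g))
    (muD : {symmetric (cotangent g)}) (j11 j1 j2 : 'End(g)) :
  orthogonal_structure mu ->
  (forall x y : g, theta x y = mu x y) ->
  (forall x y : g, mu (j1 x) y = mu x (j1 y)) ->
  (forall f h : dual g,
    h ((j2 \o theta^-1)%VF f) = f ((j2 \o theta^-1)%VF h)) ->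
  (forall (x y : g) (f h : dual g),
    muD (x, f) (y, h) = h (j11 x) + f (j11 y)
      + h ((j2 \o theta^-1)%VF f) + (theta \o j1)%VF x y) ->
  forall phi : 'End(cotangent g),
  prederivation phi -> skew_for muD phi ->
  exists alpha1 alpha2 j1' j2' : 'End(g),
    [/\ prederivation alpha1 /\ prederivation alpha2,
        precentroid j1' /\ precentroid j2',
        forall (x : g) (f : dual g),
          phi (x, f) = (alpha1 x + (j1' \o theta^-1)%VF f,
                        (theta \o alpha2)%VF x + (tr j2' - tr alpha1) f)
      & [/\ (theta \o j1 \o alpha1)%VF + (tr alpha1 \o theta \o j1)%VF
              + (tr alpha2 \o theta \o j11)%VF
              + (tr j11 \o theta \o alpha2)%VF = 0,
            (((j11 \o j1') + (j2' \o j2) - (alpha1 \o j2)) \o theta^-1)%VF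
              + (j2 \o theta^-1 \o (tr j2' - tr alpha1))%VF
              + (tr_dual theta^-1 \o tr j1' \o tr j11)%VF = 0
          & lfun_comm j11 alpha1 + (j2 \o alpha2)%VF + (j2' \o j11)%VF
              + (tr_dual theta^-1 \o tr j1' \o theta \o j1)%VF = 0]].
Proof.
move=> [nmu invmu] thetaE j1C j2C muDE phi pphi skphi.
have muC x y : mu x y = mu y x.
  by have := hermC mu x y; rewrite expr0 mul1r.
have theta0 : lker theta == 0%VS.
  rewrite -subv0; apply/subvP=> x; rewrite memv_ker => /eqP tx.
  rewrite -(eqP nmu); apply/mem_orthovP => y _.
  by rewrite -thetaE tx lfunE.
have thetaK : cancel theta theta^-1%VF := lker0_lfunK theta0.
have thetaVK := lker0_dual_lfunVK theta0.
have theta_ad x y : theta [lie x, y] = coad x (theta y).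
  apply/lfunP => z; rewrite coad_apply !thetaE; apply/eqP; rewrite -addr_eq0.
  by rewrite invmu.
have j12C x y : (theta \o j1)%VF x y = (theta \o j1)%VF y x.
  by rewrite !comp_lfunE !thetaE j1C muC.
have [j2' [alpha1 [beta [psi [pj pa phiE [beta_lie psi_ad _]]]]]] :=
  skew_prederivation_form j12C j2C muDE pphi skphi.
case=> c1 c2 c3.
have betaE x : theta ((theta^-1 \o beta)%VF x) = beta x.
  by rewrite comp_lfunE thetaVK.
have psiE f : (psi \o theta)%VF (theta^-1%VF f) = psi f.
  by rewrite comp_lfunE thetaVK.
have psitE x : (psi \o theta)%VF x = psi (theta x) by rewrite comp_lfunE.
move: (theta^-1 \o beta)%VF betaE (psi \o theta)%VF psiE psitE.
move=> alpha2 betaE j1' psiE psitE.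
exists alpha1, alpha2, j1', j2'; split; first split=> //.
- move=> x y z; apply: (can_inj thetaK).
  rewrite betaE beta_lie -!betaE !linearD /= (lie_anti (alpha2 x)).
  rewrite (lie_anti (alpha2 y)) !linearN /= !theta_ad; zmodule.
- split=> // x y; apply/lfunP => z.
  rewrite /lfun_comm !(add_lfunE, opp_lfunE, comp_lfunE, zero_lfunE, adE).
  rewrite !psitE !theta_ad.
  have /lfunP/(_ (theta z)) := psi_ad x y.
  by rewrite !comp_lfunE !adE => ->; rewrite subrr.
- by move=> x f; rewrite phiE !comp_lfunE psiE betaE.
split.
- apply/lfunP => x; apply/lfunP => y; rewrite !(add_lfunE, zero_lfunE).
  have := c1 x y; rewrite !comp_lfunE !trE !comp_lfunE => <-.
  rewrite -!betaE !thetaE (j1C (alpha1 y)) (muC (j1 x)) (muC (j11 x)); ring.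
- move: (tr_dual theta^-1)%VF (tr_dualE theta^-1%VF) => ttheta tthetaE.
  apply/lfunP => f; apply: dual_separates => h.
  have j2E (k l : dual g) : l (j2 (theta^-1%VF k)) = k (j2 (theta^-1%VF l)).
    by have := j2C k l; rewrite !comp_lfunE.
  have := c2 f h; rewrite zero_lfunE linear0.
  rewrite !add_lfunE !comp_lfunE !add_lfunE !opp_lfunE !trE.
  rewrite !comp_lfunE !linearD !linearN /= tthetaE.
  rewrite !(j2E _ h) !comp_lfunE !psiE => <-; ring.
move: (tr_dual theta^-1)%VF (tr_dualE theta^-1%VF) => ttheta tthetaE.
move: (tr_dual psi) (tr_dualE psi) c3 => psit psitrE c3.
apply/lfunP => x; apply: dual_separates => h.
have /lfunP/(_ x)/(congr1 h) := c3.
rewrite !(add_lfunE, comp_lfunE, trE) -betaE thetaK !linearD /=.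
by rewrite tthetaE psitrE !comp_lfunE psiE.
Qed.

Theorem theoremB (R : realType) :
  (forall (g : lieAlgType R) (muD : {symmetric (cotangent g)})
      (j11 : 'End(g)) (j12 : 'Hom(g, dual g)) (j21 : 'Hom(dual g, g)),
    orthogonal_structure muD ->
    (forall x : g, (j11 \o ad x = ad x \o j11)%VF) ->
    (forall x : g, (j12 \o ad x = coad x \o j12)%VF) ->
    (forall x : g, (j21 \o coad x)%VF = 0 /\ (ad x \o j21)%VF = 0) ->
    (forall x y : g, j12 x y = j12 y x) ->
    (forall f h : dual g, h (j21 f) = f (j21 h)) ->
    (forall (x y : g) (f h : dual g),
      muD (x, f) (y, h) = h (j11 x) + f (j11 y) + h (j21 f) + j12 x y) ->
    forall phi : 'End(cotangent g),
    prederivation phi -> skew_for muD phi ->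
    exists (j' alpha : 'End(g)) (beta : 'Hom(g, dual g))
           (psi : 'Hom(dual g, g)),
      [/\ precentroid j', prederivation alpha,
          forall (x : g) (f : dual g),
            phi (x, f) = (alpha x + psi f, beta x + (tr j' - tr alpha) f),
          [/\ forall x y z : g,
                beta [lie x, [lie y, z]] =
                  - coad [lie y, z] (beta x)
                  + coad x (coad y (beta z) - coad z (beta y)),
              forall x y : g,
                (psi \o coad x \o coad y = ad x \o ad y \o psi)%VF
            & forall (x : g) (f h : dual g),
                coad x (coad (psi f) h - coad (psi h) f) = 0]
        & [/\ forall x y : g,
                beta x (j11 y) + beta y (j11 x)
                + j12 (alpha x) y + j12 (alpha y) x = 0,
              forall f h : dual g,
                f (j11 (psi h)) + h (j11 (psi f))
                + f (j' (j21 h)) + h (j' (j21 f))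
                - f (alpha (j21 h)) - h (alpha (j21 f)) = 0
            & lfun_comm j11 alpha + (j21 \o beta)%VF + (j' \o j11)%VF
                + (tr_dual psi \o j12)%VF = 0]])
  /\
  (forall (g : lieAlgType R) (mu : {symmetric g}) (theta : 'Hom(g, dual g))
      (muD : {symmetric (cotangent g)}) (j11 j1 j2 : 'End(g)),
    orthogonal_structure mu ->
    (forall x y : g, theta x y = mu x y) ->
    orthogonal_structure muD ->
    centroid j11 -> centroid j1 -> centroid j2 ->
    bijective j11 ->
    (forall x y : g, mu (j1 x) y = mu x (j1 y)) ->
    (forall x : g, (j2 \o ad x)%VF = 0) ->
    (forall f h : dual g,
      h ((j2 \o theta^-1)%VF f) = f ((j2 \o theta^-1)%VF h)) ->
    (forall (x y : g) (f h : dual g),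
      muD (x, f) (y, h) = h (j11 x) + f (j11 y)
        + h ((j2 \o theta^-1)%VF f) + (theta \o j1)%VF x y) ->
    forall phi : 'End(cotangent g),
    prederivation phi -> skew_for muD phi ->
    exists alpha1 alpha2 j1' j2' : 'End(g),
      [/\ prederivation alpha1 /\ prederivation alpha2,
          precentroid j1' /\ precentroid j2',
          forall (x : g) (f : dual g),
            phi (x, f) = (alpha1 x + (j1' \o theta^-1)%VF f,
                          (theta \o alpha2)%VF x + (tr j2' - tr alpha1) f)
        & [/\ (* The matrix form of the first scalar condition above, with      *)
              (* beta = theta \o alpha2 and j12 = theta \o j1; its symmetry in *)
              (* x and y is what produces the last summand.                    *)
              (theta \o j1 \o alpha1)%VF + (tr alpha1 \o theta \o j1)%VF
                + (tr alpha2 \o theta \o j11)%VF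
                + (tr j11 \o theta \o alpha2)%VF = 0,
              (((j11 \o j1') + (j2' \o j2) - (alpha1 \o j2)) \o theta^-1)%VF
                + (j2 \o theta^-1 \o (tr j2' - tr alpha1))%VF
                + (tr_dual theta^-1 \o tr j1' \o tr j11)%VF = 0
            & lfun_comm j11 alpha1 + (j2 \o alpha2)%VF + (j2' \o j11)%VF
                + (tr_dual theta^-1 \o tr j1' \o theta \o j1)%VF = 0]])
  /\
  (forall g : lieAlgType R, semisimple g ->
    forall (muD : {symmetric (cotangent g)}) (phi : 'End(cotangent g)),
    orthogonal_structure muD ->
    prederivation phi -> skew_for muD phi ->
    inner_derivation phi).
Proof.
split; [|split].
- move=> g muD j11 j12 j21 _ _ _ _ j12C j21C muDE.
  exact: (skew_prederivation_form j12C j21C muDE).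
- move=> g mu theta muD j11 j1 j2 omu thetaE _ _ _ _ _ j1C _ j2C muDE.
  exact: (skew_prederivation_form_orthogonal omu thetaE j1C j2C muDE).
- move=> g ssg muD phi oB pphi skphi.
  exact: (semisimple_skew_prederivation_inner ssg oB pphi skphi).
Qed.
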